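(* Let $x,x_1,x_2$ be roots of unity and $p_1,p_2,q\ge1$ integers with $(p_1,x_1),(p_2,x_2),(q,xx_1x_2)\neq(1,1)$. Write $X=xx_1x_2$ and let $\sum_\sigma$ denote the sum over $\sigma\in\{(1,2),(2,1)\}$, i.e. $\sum_\sigma f(\sigma(1),\sigma(2))=f(1,2)+f(2,1)$. Then \begin{align*} &X^{-1}R_{p_1,p_2;q}\big(x_1,x_2;X^{-1}\big)+(-1)^{p_1+p_2+q}R_{p_1,p_2;q}\big(x_1^{-1},x_2^{-1};X\big)\\ &=-\mathrm{Li}_{p_1}(x_1)\mathrm{Li}_{p_2}(x_2)\mathrm{ti}_q(X^{-1})+X^{-1}\sum_\sigma\mathrm{Li}_{p_{\sigma(1)}}(x_{\sigma(1)})R_{p_{\sigma(2)};q}\big(x_{\sigma(2)};X^{-1}\big)\\ &\quad-(-1)^qX^{-1}\binom{q+p_1+p_2-1}{q-1}\mathrm{ti}_{q+p_1+p_2}(X)\\ &\quad-(-1)^q\sum_\sigma\sum_{k=0}^{p_{\sigma(1)}}\binom{k+p_{\sigma(2)}-1}{p_{\sigma(2)}-1}\binom{q+p_{\sigma(1)}-k-1}{q-1}\Big\{X^{-1}(-1)^k\mathrm{Li}_{k+p_{\sigma(2)}}(x_{\sigma(2)})\mathrm{ti}_{q+p_{\sigma(1)}-k}(X)\\ &\qquad\qquad+(-1)^{p_{\sigma(2)}}R_{k+p_{\sigma(2)};p_{\sigma(1)}+q-k}\big(x_{\sigma(2)}^{-1};X\big)\Big\}\\ &\quad-(-1)^qX^{-1}\sum_{k=0}^{p_1+p_2-1}\binom{q+p_1+p_2-k-2}{q-1}\Big((-1)^k\mathrm{Li}_{k+1}(x)-\mathrm{Li}_{k+1}(x^{-1})\Big)\mathrm{ti}_{q+p_1+p_2-k-1}(X)\\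 &\quad-(-1)^qX^{-1}\mathrm{Li}_{p_1}(x_1)\mathrm{Li}_{p_2}(x_2)\mathrm{ti}_q(X)-(-1)^q\sum_\sigma(-1)^{p_{\sigma(2)}}\mathrm{Li}_{p_{\sigma(1)}}(x_{\sigma(1)})R_{p_{\sigma(2)};q}\big(x_{\sigma(2)}^{-1};X\big)\\ &\quad-(-1)^q\sum_\sigma\sum_{\substack{k_1,k_2\ge0\\k_1+k_2\le p_{\sigma(1)}-1}}\binom{k_2+p_{\sigma(2)}-1}{p_{\sigma(2)}-1}\binom{q+p_{\sigma(1)}-k_1-k_2-2}{q-1}\Big((-1)^{k_1}\mathrm{Li}_{k_1+1}(x)-\mathrm{Li}_{k_1+1}(x^{-1})\Big)\\ &\qquad\times\Big\{X^{-1}(-1)^{k_2}\mathrm{Li}_{k_2+p_{\sigma(2)}}(x_{\sigma(2)})\mathrm{ti}_{q+p_{\sigma(1)}-k_1-k_2-1}(X)+(-1)^{p_{\sigma(2)}}R_{k_2+p_{\sigma(2)};p_{\sigma(1)}+q-k_1-k_2-1}\big(x_{\sigma(2)}^{-1};X\big)\Big\}\\ &\quad-\sum_{\substack{k_1+k_2+k_3=q-1\\k_1,k_2,k_3\ge0}}\Big((-1)^{k_1}\mathrm{ti}_{k_1+1}(x)-x\,\mathrm{ti}_{k_1+1}(x^{-1})\Big)(-1)^{k_2+k_3}\binom{k_2+p_1-1}{p_1-1}\binom{k_3+p_2-1}{p_2-1}X^{-1}\mathrm{ti}_{k_2+p_1}(x_1)\mathrm{ti}_{k_3+p_2}(x_2).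 \end{align*}
   Context: For $p\in\mathbb{N}$, $n\ge0$, root of unity $z$: $\zeta_n(p;z)=\sum_{k=1}^n z^k/k^p$ (empty sum $0$). For $|z|\le1$, $(m,z)\ne(1,1)$: $\mathrm{Li}_m(z)=\sum_{n\ge1}z^n/n^m$, $\mathrm{ti}_m(z)=\sum_{n\ge1}z^n/(n-1/2)^m$. For positive integers $p_1,\ldots,p_k,q$ and roots of unity $z_1,\ldots,z_k,z$ with $(q,z)\ne(1,1)$: $R_{p_1,\ldots,p_k;q}(z_1,\ldots,z_k;z)=\sum_{n\ge0}\frac{\zeta_n(p_1;z_1)\cdots\zeta_n(p_k;z_k)}{(n+1/2)^q}z^n$. *)

(* Defs.v *)
From HB Require Import structures.
From mathcomp Require Import all_boot all_order all_algebra.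
From mathcomp Require Import all_classical all_reals all_analysis.
From mathcomp Require Import complex.
Set Implicit Arguments.
Unset Strict Implicit.
Unset Printing Implicit Defensive.
Import Order.TTheory GRing.Theory Num.Theory.
Import numFieldNormedType.Exports.
Local Open Scope ring_scope.
Local Open Scope complex_scope.

(* 0 < n is needed: 0.-unity_root holds of every z. *)
Definition is_root_of_unity (R : realType) (z : R[i]) : Prop :=
  exists2 n : nat, (0 < n)%N & n.-unity_root z.

(* Limit of the partial sums u 0 + ... + u n.-1 for the topology of the modulus,
   which the library puts on the regular module R[i]^o. *)
Definition csum (R : realType) (u : nat -> R[i]) : R[i] :=
  limn (series (u : nat -> R[i]^o)).

Definition zeta (R : realType) (n p : nat) (z : R[i]) : R[i] :=
  \sum_(1 <= k < n.+1) z ^+ k / k%:R ^+ p.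

(* Li 1 1 and ti 1 1 are limits of divergent series, hence unspecified values;
   such a value cancels in Li 1 x - Li 1 x^-1 and in ti 1 x - x * ti 1 x^-1 at
   x = 1, so that these differences are 0 there, as they are in the constant
   terms of the expansions of pi * cot (pi * s) they stand for. *)
Definition Li (R : realType) (m : nat) (z : R[i]) : R[i] :=
  csum (fun n => z ^+ n.+1 / n.+1%:R ^+ m).

Definition ti (R : realType) (m : nat) (z : R[i]) : R[i] :=
  csum (fun n => z ^+ n.+1 / (n.+1%:R - 2^-1) ^+ m).

(* R_{p_1,...,p_k;q}(z_1,...,z_k;z) with pz = [:: (p_1, z_1); ...; (p_k, z_k)]. *)
Definition Rsum (R : realType) (pz : seq (nat * R[i])) (q : nat) (z : R[i])
    : R[i] :=
  csum (fun n =>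
    (\prod_(a <- pz) zeta n a.1 a.2) / (n%:R + 2^-1) ^+ q * z ^+ n).

(* F receives p_{sigma(1)}, x_{sigma(1)}, p_{sigma(2)}, x_{sigma(2)}. *)
Definition sum_sigma (R : realType) (p1 : nat) (x1 : R[i]) (p2 : nat)
    (x2 : R[i]) (F : nat -> R[i] -> nat -> R[i] -> R[i]) : R[i] :=
  F p1 x1 p2 x2 + F p2 x2 p1 x1.

(* Main.v *)
(** Truncate the kernels to rational functions: with
    Phi_N(s) = sum_(|a| <= N) x^a / (s + a) and
    phi_K(s; p, z) = sum_(0 <= k <= K) z^k / (s + k)^p, the product
    Phi_N(s) phi_K(s; p1, x1) phi_K(s; p2, x2) / (s - 1/2)^q is O(s^-2) at
    infinity, so its residues add up to 0.  The residues at s = -n with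
    0 <= n <= K, at s = m with 1 <= m <= N, and at s = 1/2 are the finite
    counterparts of the terms of the formula; those at s = -n with K < n <= N
    have no counterpart and vanish in the limit.  Then K tends to infinity with
    N = K^2 + K.  All error terms come from the single estimate
    zeta_b(p; z) - zeta_a(p; z) = O(1/(a + 1)) for a <= b and (p, z) <> (1, 1),
    obtained by Abel summation when p = 1. *)

Require Import Defs.
From HB Require Import structures.
From mathcomp Require Import all_boot all_order all_algebra.
From mathcomp Require Import all_classical all_reals all_analysis.
From mathcomp Require Import complex.
From mathcomp Require Import ring lra zify.
Set Implicit Arguments.
Unset Strict Implicit.
Unset Printing Implicit Defensive.
Import Order.TTheory GRing.Theory Num.Theory.
Import numFieldNormedType.Exports.
Local Open Scope ring_scope.
Local Open Scope complex_scope.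

(** * Residues of products of simple fractions *)

(** The untruncated kernels are of cotangent and polygamma type, and their residue calculus would
    call for contour integrals and growth estimates. For rational functions the residue theorem is
    pure algebra over any field: an expansion at a center is a polynomial known modulo a power of
    ['X], and the residue is one of its coefficients. The price is that the residue at - n contains
    partial sums of lengths K - n, N - n, N + n and n, so the limit cannot be taken term by term:
    for n near K the sum of length K - n is far from its limit. The decay of the weight (n + 1/2)^-q
    compensates for this. The second parameter N serves the case x = 1, where the two-sided kernel
    leaves the piece of the harmonic series between N - n and N + n. For N = K that piece is about
    log((K + n)/(K - n + 1)), and its sum against 1/n stays away from 0. A larger N creates the
    extra poles with K < n <= N, harmless because there each phi_K is only a difference of two
    partial sums. *)

Lemma addDB (V : zmodType) (x y : V) : x + y - x = y.
Proof. by rewrite addrC addKr. Qed.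

Section Residues.
Variables (F : fieldType) (M : nat).
Implicit Types (p q r : {poly F}) (c d : F) (s D : seq F).

Definition eqmodX p q := forall i, (i < M)%N -> p`_i = q`_i.

Lemma eqmodX_refl p : eqmodX p p. Proof. by []. Qed.

Lemma eqmodX_sym p q : eqmodX p q -> eqmodX q p.
Proof. by move=> h i iM; rewrite h. Qed.

Lemma eqmodX_trans q p r : eqmodX p q -> eqmodX q r -> eqmodX p r.
Proof. by move=> h1 h2 i iM; rewrite h1 ?h2. Qed.

Lemma eqmodXM p p' q q' : eqmodX p p' -> eqmodX q q' -> eqmodX (p * q) (p' * q').
Proof.
move=> hp hq i iM; rewrite !coefM; apply: eq_bigr => -[j /= ji] _.
by rewrite hp ?hq //; lia.
Qed.

(* The expansion of (c + 'X) ^- m truncated at 'X^M. *)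
Definition invpow m c : {poly F} :=
  \poly_(j < M) ((-1) ^+ j * 'C(m + j - 1, j)%:R * c ^- (m + j)).

Lemma coef_invpow m c j : (j < M)%N ->
  (invpow m c)`_j = (-1) ^+ j * 'C(m + j - 1, j)%:R * c ^- (m + j).
Proof. by move=> jM; rewrite coef_poly jM. Qed.

Lemma invpow0 c : eqmodX (invpow 0 c) 1.
Proof.
move=> [|i] iM; rewrite coef_invpow // coef1 /=.
  by rewrite expr0 bin0 invr1 !mulr1.
by rewrite bin_small ?mulr0 ?mul0r //; lia.
Qed.

(** On coefficients this is Pascal's rule. *)
Lemma invpowS m c : c != 0 ->
  eqmodX ((c%:P + 'X) * invpow m.+1 c) (invpow m c).
Proof.
move=> c0 [|j] jM; rewrite mulrDl coefD coefCM coefXM /= !coef_invpow //; last lia.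
  rewrite !addn0 subn1 /= !expr0 !bin0 !mul1r addr0 exprS invfM mulrA.
  by rewrite mulfV // mul1r.
rewrite (_ : (m.+1 + j.+1 - 1 = (m + j).+1)%N); last lia.
rewrite (_ : (m.+1 + j - 1 = (m + j))%N); last lia.
rewrite (_ : (m + j.+1 - 1 = (m + j))%N); last lia.
rewrite binS natrD (_ : (m.+1 + j.+1 = (m + j).+2)%N); last lia.
rewrite (_ : (m.+1 + j = (m + j).+1)%N); last lia.
rewrite (_ : (m + j.+1 = (m + j).+1)%N); last lia.
by rewrite -!exprVn !exprS; field.
Qed.

(* The function (s - c) ^- m expanded at d is 'X^-m times [pole m (d - c)]. *)
Definition pole m c : {poly F} := if c == 0 then 1 else 'X^m * invpow m c.

Lemma pole_mulX c : eqmodX ((c%:P + 'X) * pole 1 c) 'X.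
Proof.
rewrite /pole; case: eqVneq => [->|c0]; first by rewrite add0r mulr1.
rewrite mulrCA -[X in eqmodX _ X]mulr1; apply: eqmodXM => //.
exact: eqmodX_trans (invpowS 0 c0) (invpow0 c).
Qed.

(** Avoids a convolution of binomials: [invpow 1 c] is an inverse of [c%:P + 'X], and multiplying by
    [c%:P + 'X] lowers the exponent of [invpow] by one. *)
Lemma invpow_exp m c : c != 0 -> eqmodX (invpow m c) (invpow 1 c ^+ m).
Proof.
move=> c0; elim: m => [|m IH]; first by rewrite expr0; exact: invpow0.
rewrite exprS; apply: (@eqmodX_trans (invpow 1 c * ((c%:P + 'X) * invpow m.+1 c))).
  rewrite mulrA -{1}[invpow m.+1 c]mul1r; apply: eqmodXM => //.
  rewrite mulrC; apply: eqmodX_sym.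
  exact: eqmodX_trans (invpowS 0 c0) (invpow0 c).
apply: eqmodXM => //; apply: eqmodX_trans IH; exact: invpowS.
Qed.

Lemma pole_exp m c : eqmodX (pole m c) (pole 1 c ^+ m).
Proof.
rewrite /pole; case: eqVneq => [_|c0]; first by rewrite expr1n.
by rewrite exprMn; apply: eqmodXM => //; apply: invpow_exp.
Qed.

(* Induction on the number of factors: two distinct centers are separated by
   1 / ((s - c) (s - c')) = (1 / (s - c) - 1 / (s - c')) / (c - c'). *)
Lemma sum_residues D s : uniq D -> {subset s <= D} -> (0 < size s <= M)%N ->
  \sum_(d <- D) (\prod_(c <- s) pole 1 (d - c))`_(size s).-1 = (size s == 1)%:R.
Proof.
move=> uD; have [n] := ubnP (size s); elim: n s => // n IH s sn sD /andP[s0 sM].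
case: s => // c s in sn sD s0 sM *.
(* If all centers coincide the function is a pure power of 1 / (s - c), with residue 1 exactly when
   the exponent is 1. At any other point of [D] the product is divisible by ['X^(size s)] and
   contributes nothing. *)
case: (boolP (all (pred1 c) s)) => [/all_pred1P es|].
  have eprod d : \prod_(j <- c :: s) pole 1 (d - j) = pole 1 (d - c) ^+ (size s).+1.
    have -> : c :: s = nseq (size s).+1 c by rewrite {1}es.
    by rewrite big_nseq iter_mulr_1.
  rewrite /= (bigD1_seq c) ?sD ?mem_head //= eprod subrr /pole eqxx expr1n coef1.
  rewrite big1 => [|d dc]; first by rewrite addr0 eqSS.
  by rewrite eprod /pole subr_eq0 (negbTE dc) exprMn -exprM mul1n coefXnM ltnSn.
rewrite -has_predC => /hasP[c' c's /= c'c].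
have ps : perm_eq (c :: s) (c :: c' :: rem c' s).
  by rewrite perm_cons perm_to_rem.
set t := rem c' s in ps *.
have ss : size s = (size t).+1 by have := perm_size ps; case.
have tD u : u \in [:: c, c' & t] -> u \in D.
  by rewrite -(perm_mem ps); apply: sD.
have dcc : c' - c != 0 by rewrite subr_eq0.
rewrite /= ss eqSS /=; apply: (mulfI dcc); rewrite mulr0 mulr_sumr.
have key d : (c' - c) * (\prod_(j <- c :: s) pole 1 (d - j))`_(size t).+1 =
   (\prod_(j <- c' :: t) pole 1 (d - j))`_(size t)
   - (\prod_(j <- c :: t) pole 1 (d - j))`_(size t).
  rewrite (perm_big _ ps) /= !big_cons.
  set P := pole 1 (d - c); set P' := pole 1 (d - c'); set T := \prod_(j <- t) _.
  rewrite -coefCM.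
  have -> : (c' - c)%:P * (P * (P' * T))
    = ((d - c)%:P + 'X) * P * (P' * T) - ((d - c')%:P + 'X) * P' * (P * T).
    by rewrite !polyCB; ring.
  rewrite coefB; congr (_ - _).
    (* With one factor fewer the residue sits one index lower; the ['X] supplied by [pole_mulX]
       makes up for it. *)
    rewrite (_ : (P' * T)`_(size t) = ('X * (P' * T))`_(size t).+1); last by rewrite coefXM.
    by apply: (eqmodXM (pole_mulX (d - c)) (@eqmodX_refl _)); rewrite -ss.
  rewrite (_ : (P * T)`_(size t) = ('X * (P * T))`_(size t).+1); last by rewrite coefXM.
  by apply: (eqmodXM (pole_mulX (d - c')) (@eqmodX_refl _)); rewrite -ss.
rewrite (eq_bigr _ (fun d _ => key d)) sumrB.
(* The two shorter products have the same sum of residues. It is 1 if [t] is empty, so each need not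
   vanish, but their difference does. *)
have eq1 u : u \in [:: c; c'] -> \sum_(d <- D) (\prod_(j <- u :: t) pole 1 (d - j))`_(size t)
  = (size t == 0)%:R.
  move=> hu; rewrite -[size t]/((size (u :: t)).-1) IH //=.
  - by rewrite /= ss in sn.
  - move=> v; rewrite inE => /orP[/eqP->|vt]; apply: tD.
      by move: hu; rewrite !inE => /orP[] ->; rewrite ?orbT.
    by rewrite !inE vt !orbT.
  - by rewrite /= ss in sM; apply: ltnW.
by rewrite !eq1 ?subrr // !inE eqxx ?orbT.
Qed.

(** The condition [0 < m1 + m2 + m3] leaves at least two simple factors, i.e. decay O(s^-2), which
    excludes the value 1 in [sum_residues]. *)
Lemma sum_residues_pow D a b c h m1 m2 m3 : uniq D ->
  a \in D -> b \in D -> c \in D -> h \in D ->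
  (0 < m1 + m2 + m3 < M)%N ->
  \sum_(d <- D) (pole 1 (d - a) * pole m1 (d - b) * pole m2 (d - c)
                 * pole m3 (d - h))`_(m1 + m2 + m3) = 0.
Proof.
move=> uD aD bD cD hD /andP[m0 mM].
pose s := a :: nseq m1 b ++ nseq m2 c ++ nseq m3 h.
have ss : size s = (m1 + m2 + m3).+1 by rewrite /= !size_cat !size_nseq addnA.
have := @sum_residues D s uD; rewrite ss /=.
have -> : ((m1 + m2 + m3).+1 == 1)%N = false by lia.
move=> H; rewrite -{}[RHS]H; last by [].
  apply: eq_bigr => d _.
  rewrite big_cons !big_cat /= !big_nseq !iter_mulr_1 !mulrA.
  have E := eqmodXM (eqmodXM (eqmodXM (eqmodX_refl (pole 1 (d - a)))
    (pole_exp m1 (d - b))) (pole_exp m2 (d - c))) (pole_exp m3 (d - h)).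
  exact: E.
move=> u; rewrite inE !mem_cat !mem_nseq.
by case/orP => [/eqP->//|/orP[/andP[_ /eqP->]//|/orP[] /andP[_ /eqP->]//]].
Qed.

(** Residues are multilinear in the kernels. One set [D] can serve all terms of the expanded
    product, since a point of [D] that is no center of a term contributes 0 to it. *)
Lemma sum_residues_lin (I : eqType) (J : eqType) D h m1 m2 m3
    (r : seq I) (w : I -> F) (a : I -> F) (r1 r2 : seq J) (w1 w2 b c : J -> F) :
  uniq D -> (forall i, i \in r -> a i \in D) ->
  (forall j, j \in r1 -> b j \in D) -> (forall j, j \in r2 -> c j \in D) ->
  h \in D -> (0 < m1 + m2 + m3 < M)%N ->
  \sum_(d <- D) ((\sum_(i <- r) w i *: pole 1 (d - a i))
                 * (\sum_(j <- r1) w1 j *: pole m1 (d - b j))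
                 * (\sum_(j <- r2) w2 j *: pole m2 (d - c j))
                 * pole m3 (d - h))`_(m1 + m2 + m3) = 0.
Proof.
move=> uD aD bD cD hD mM.
transitivity (\sum_(d <- D) \sum_(i <- r) \sum_(j <- r1) \sum_(k <- r2)
  w i * w1 j * w2 k * (pole 1 (d - a i) * pole m1 (d - b j) * pole m2 (d - c k)
                 * pole m3 (d - h))`_(m1 + m2 + m3)).
  apply: eq_bigr => d _; rewrite !mulr_suml coef_sum; apply: eq_bigr => i _.
  rewrite [_ *: _ * \sum_(j <- r1) _]mulr_sumr !mulr_suml coef_sum; apply: eq_bigr => j _.
  rewrite mulr_sumr !mulr_suml coef_sum; apply: eq_bigr => k _.
  by rewrite -coefZ; congr (nth _ (polyseq _) _); rewrite -!mul_polyC !polyCM; ring.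
rewrite exchange_big /= big_seq big1 // => i ir.
rewrite exchange_big /= big_seq big1 // => j jr.
rewrite exchange_big /= big_seq big1 // => k kr.
by rewrite -mulr_sumr sum_residues_pow ?mulr0 ?aD ?bD ?cD.
Qed.

End Residues.

(** Counting indices by their distance from [n] is what produces partial sums of lengths K - n and n
    at the pole - n. *)
Lemma sum_recenter (V : zmodType) (f : nat -> V) n K : (n <= K)%N ->
  \sum_(0 <= k < K.+1) f k
  = f n + (\sum_(1 <= b < (K - n).+1) f (n + b)%N
           + \sum_(1 <= b < n.+1) f (n - b)%N).
Proof.
move=> nK; rewrite (big_cat_nat _ (n := n)) //=; last lia.
rewrite (@big_cat_nat _ _ _ n.+1 n) //=.
rewrite big_nat1 addrCA; congr (_ + _); rewrite addrC; congr (_ + _).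
  by rewrite -[n.+1]add1n big_addn subSn //; apply: eq_bigr => b _; rewrite addnC.
by rewrite big_nat_rev /= big_add1 /=; apply: eq_bigr => b _; rewrite add0n.
Qed.

(** A kernel at one of its own poles is a principal part 1 plus a regular part shifted by the order
    of the pole. Of the eight products, the one with all three regular parts starts at
    ['X^((p1 + p2).+1)] and drops out; the other seven give the groups of terms of the formula. *)
Lemma coef_mul_principal (F : fieldType) (A B1 B2 G : {poly F}) p1 p2 :
  (0 < p1)%N -> (0 < p2)%N ->
  ((1 + 'X * A) * (1 + 'X^p1 * B1) * (1 + 'X^p2 * B2) * G)`_(p1 + p2)
  = G`_(p1 + p2) + ((B2 * G)`_p1 + (B1 * G)`_p2) + (A * G)`_(p1 + p2).-1
    + (B1 * B2 * G)`_0 + ((A * (B2 * G))`_p1.-1 + (A * (B1 * G))`_p2.-1).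
Proof.
move=> p10 p20.
have -> : (1 + 'X * A) * (1 + 'X^p1 * B1) * (1 + 'X^p2 * B2) * G
  = G + 'X^p2 * (B2 * G) + 'X^p1 * (B1 * G) + 'X^1 * (A * G)
    + 'X^(p1 + p2) * (B1 * B2 * G) + 'X^(p2.+1) * (A * (B2 * G))
    + 'X^(p1.+1) * (A * (B1 * G)) + 'X^((p1 + p2).+1) * (A * B1 * B2 * G).
  by rewrite !exprS exprD; ring.
rewrite !coefD !coefXnM ltnSn ltnn subnn.
rewrite !ifF; try lia.
rewrite addnK addKn subn1 addr0.
rewrite (_ : (p1 + p2 - p2.+1 = p1.-1)%N); last lia.
rewrite (_ : (p1 + p2 - p1.+1 = p2.-1)%N); last lia.
ring.
Qed.

Lemma sum_compositions3 (V : nmodType) q (f : nat -> nat -> nat -> V) : (0 < q)%N ->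
  \sum_(k1 < q) \sum_(k2 < (q.-1 - k1).+1) f k1 k2 (q.-1 - k1 - k2)%N
  = \sum_(k1 < q) \sum_(k2 < q) \sum_(k3 < q | (k1 + k2 + k3 == q - 1)%N) f k1 k2 k3.
Proof.
move=> q0; apply: eq_bigr => -[k1 /= k1q] _.
rewrite (big_ord_widen q (fun k2 => f k1 k2 (q.-1 - k1 - k2)%N)); last lia.
rewrite big_mkcond; apply: eq_bigr => -[k2 /= k2q] _.
case: ltnP => hk.
  have k3q : (q.-1 - k1 - k2 < q)%N by lia.
  rewrite (big_pred1 (Ordinal k3q)) // => -[k3 k3q'] /=.
  by rewrite -val_eqE /=; apply/eqP/eqP; lia.
by rewrite big_pred0 // => -[k3 k3q'] /=; apply/negbTE/eqP; lia.
Qed.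

Lemma coef_mulX4 (F : fieldType) (P A B G : {poly F}) p1 p2 q :
  (P * ('X^p1 * A) * ('X^p2 * B) * ('X^q * G))`_(p1 + p2 + q)
  = P`_0 * A`_0 * B`_0 * G`_0.
Proof.
have -> : P * ('X^p1 * A) * ('X^p2 * B) * ('X^q * G)
  = 'X^(p1 + p2 + q) * (P * A * B * G) by rewrite !exprD; ring.
by rewrite coefXnM ltnn subnn !coef0M.
Qed.

(** * The finite identity *)

Section FiniteIdentity.
Variable R : realType.
Implicit Types (z : R[i]) (p n K N j r : nat).

Definition ti_part N p z : R[i] :=
  \sum_(1 <= k < N.+1) z ^+ k / (k%:R - 2^-1) ^+ p.

Lemma natrB_neq0 n k : n != k -> (n%:R - k%:R : R[i]) != 0.
Proof. by rewrite subr_eq0 eqr_nat. Qed.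

Lemma half_neq_nat k : (2^-1 : R[i]) != k%:R.
Proof.
apply/eqP => h; have : (1 : R[i]) = (2 * k)%:R by rewrite natrM -h mulfV ?pnatr_eq0.
by move/eqP; rewrite -[1]/(1%:R) eqr_nat; lia.
Qed.

Lemma half_natrD_neq0 k : (k%:R + 2^-1 : R[i]) != 0.
Proof.
by rewrite lt0r_neq0 // ltr_wpDl ?ler0n // invr_gt0 ltr0n.
Qed.

Lemma half_natrB_neq0 k : (k%:R - 2^-1 : R[i]) != 0.
Proof. by rewrite subr_eq0 eq_sym half_neq_nat. Qed.

Lemma natrS_half k : k.+1%:R - 2^-1 = k%:R + 2^-1 :> R[i].
Proof.
by rewrite -natr1; field.
Qed.

(** * Local expansions of the truncated kernels *)

Section Local.
Variable M : nat.

Lemma pole_neq0 p (c : R[i]) : c != 0 -> pole M p c = 'X^p * invpow M p c.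
Proof. by rewrite /pole => /negbTE->. Qed.

Lemma pole00 p : pole M p (0 : R[i]) = 1. Proof. by rewrite /pole eqxx. Qed.

Lemma coef_invpowN j p (c : R[i]) : (j < M)%N ->
  (invpow M p (- c))`_j = (-1) ^+ p * 'C(p + j - 1, j)%:R / c ^+ (p + j).
Proof.
move=> jM; rewrite coef_invpow // [(- c) ^+ _]exprNn invfM.
have -> : ((-1) ^+ (p + j))^-1 = (-1) ^+ p * (-1) ^+ j :> R[i].
  by rewrite -exprVn invrN invr1 exprD.
have ss : (-1) ^+ j * (-1) ^+ j = 1 :> R[i] by rewrite -exprMn mulrNN mulr1 expr1n.
transitivity ((-1) ^+ j * (-1) ^+ j
  * ((-1) ^+ p * 'C(p + j - 1, j)%:R / c ^+ (p + j))); first by ring.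
by rewrite ss mul1r.
Qed.

(** What remains of a kernel around one of its poles once that pole is removed and its weight
    divided out: [a] further poles on the left, [b] on the right. *)
Definition regular_part p z a b : {poly R[i]} :=
  \sum_(1 <= k < a.+1) z ^+ k *: invpow M p k%:R
  + \sum_(1 <= k < b.+1) z^-1 ^+ k *: invpow M p (- k%:R).

Lemma coef_regular_part p z a b j : (j < M)%N ->
  (regular_part p z a b)`_j = 'C(p + j - 1, j)%:R
    * ((-1) ^+ j * zeta a (p + j) z + (-1) ^+ p * zeta b (p + j) z^-1).
Proof.
move=> jM; rewrite coefD !coef_sum mulrDr /zeta !mulr_sumr; congr (_ + _);
  apply: eq_bigr => k _; rewrite coefZ.
  by rewrite coef_invpow //; ring.
by rewrite coef_invpowN //; ring.
Qed.

Lemma sum_pole_at p z n K : (n <= K)%N -> z != 0 ->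
  \sum_(0 <= k < K.+1) z ^+ k *: pole M p (- n%:R - - k%:R)
  = z ^+ n *: (1 + 'X^p * regular_part p z (K - n) n).
Proof.
move=> nK z0; rewrite (sum_recenter _ nK) opprK addNr pole00 scalerDr.
congr (_ + _); rewrite /regular_part mulrDr scalerDr !mulr_sumr !scaler_sumr.
congr (_ + _); apply: eq_big_nat => b /andP[b1 bn].
  rewrite exprD -scalerA -scalerAr; congr (_ *: (_ *: _)).
  rewrite pole_neq0 ?natrD ?opprK ?addKr //.
  by rewrite pnatr_eq0; lia.
rewrite -scalerAr exprB ?unitfE //.
rewrite exprVn scalerA; congr (_ *: _).
rewrite natrB; last lia.
rewrite opprK addKr pole_neq0 // oppr_eq0 pnatr_eq0; lia.
Qed.

(** Seen from - n, the pole at k > 0 lies at distance n + k. The positive poles thus continue the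
    run of the n poles from - n + 1 to 0, which explains the unequal lengths N - n and N + n. *)
Lemma sum_pole_twosided_at z n N : (n <= N)%N -> z != 0 ->
  \sum_(0 <= k < N.+1) z ^+ k *: pole M 1 (- n%:R - - k%:R)
  + \sum_(1 <= k < N.+1) z^-1 ^+ k *: pole M 1 (- n%:R - k%:R)
  = z ^+ n *: (1 + 'X * regular_part 1 z (N - n) (N + n)).
Proof.
move=> nN z0; rewrite sum_pole_at //.
have zn0 : z ^+ n != 0 by rewrite expf_neq0.
have -> : \sum_(1 <= k < N.+1) z^-1 ^+ k *: pole M 1 (- n%:R - k%:R)
  = z ^+ n *: ('X * \sum_(n.+1 <= k < (N + n).+1) z^-1 ^+ k *: invpow M 1 (- k%:R)).
  rewrite -[n.+1]add1n big_addn (_ : ((N + n).+1 - n = N.+1)%N); last lia.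
  rewrite mulr_sumr scaler_sumr; apply: eq_big_nat => b /andP[b1 bn].
  rewrite -scalerAr scalerA exprD -opprD -natrD pole_neq0; last first.
    by rewrite oppr_eq0 pnatr_eq0; lia.
  by rewrite addnC mulrCA !exprVn mulfV ?mulr1 // expr1.
rewrite -scalerDr expr1 -addrA -mulrDr; congr (_ *: (_ + _ * _)).
rewrite /regular_part -addrA; congr (_ + _).
by rewrite -big_cat_nat //; lia.
Qed.

Lemma sum_pole_far p z (d : R[i]) K : (forall k, (k <= K)%N -> d + k%:R != 0) ->
  \sum_(0 <= k < K.+1) z ^+ k *: pole M p (d - - k%:R)
  = 'X^p * \sum_(0 <= k < K.+1) z ^+ k *: invpow M p (d + k%:R).
Proof.
move=> h; rewrite mulr_sumr; apply: eq_big_nat => k /andP[_ kK].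
by rewrite opprK pole_neq0 ?h // scalerAr.
Qed.

Lemma coef0_invpow p (c : R[i]) : (0 < M)%N -> (invpow M p c)`_0 = c ^- p.
Proof. by move=> M0; rewrite coef_invpow // expr0 bin0 !mul1r addn0. Qed.

(** Away from its poles a kernel enters through its value alone, a window of K + 1 consecutive terms
    of the series: those from m + 1 on at s = m + 1, those up to n at s = - n in [sum_far_neg]. *)
Lemma sum_far_pos p z m K : (0 < M)%N -> z != 0 ->
  (\sum_(0 <= k < K.+1) z ^+ k *: invpow M p (m.+1%:R + k%:R))`_0
  = z^-1 ^+ m.+1 * (zeta (K + m.+1) p z - zeta m p z).
Proof.
move=> M0 z0; have zm0 : z ^+ m.+1 != 0 by rewrite expf_neq0.
rewrite /zeta (@big_cat_nat _ _ _ m.+1 1 (K + m.+1).+1) //=; last lia.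
rewrite addDB -{3}[m.+1]add0n big_addn -addSn addnK coef_sum mulr_sumr.
apply: eq_bigr => k _.
rewrite coefZ coef0_invpow // -natrD addnC exprD exprVn.
by rewrite [z ^+ k * _]mulrC mulrA mulKf.
Qed.

Lemma sum_far_neg p z n K : (0 < M)%N -> z != 0 -> (K < n)%N ->
  (\sum_(0 <= k < K.+1) z ^+ k *: invpow M p (- n%:R + k%:R))`_0
  = z ^+ n * ((-1) ^+ p * (zeta n p z^-1 - zeta (n - K.+1) p z^-1)).
Proof.
move=> M0 z0 Kn; rewrite /zeta (@big_cat_nat _ _ _ (n - K.+1).+1 1 n.+1) //=; last lia.
rewrite addDB coef_sum !mulr_sumr.
rewrite big_nat_rev /= add0n.
rewrite -[(n - K.+1).+1 in RHS]add0n big_addn (_ : (n.+1 - (n - K.+1).+1 = K.+1)%N); last lia.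
apply: eq_big_nat => k /andP[_ kK].
rewrite coefZ.
have -> : - n%:R + (K.+1 - k.+1)%:R = - (n - (K.+1 - k.+1))%:R :> R[i].
  by rewrite [in RHS]natrB ?opprB 1?addrC //; lia.
rewrite coef_invpowN // addn0 bin0 mulr1.
rewrite (_ : (n - (K.+1 - k.+1) = k + (n - K.+1).+1)%N); last lia.
rewrite (_ : (K.+1 - k.+1 = n - (k + (n - K.+1).+1))%N); last lia.
rewrite exprB ?unitfE //; last lia.
by rewrite exprVn; ring.
Qed.

Definition half_part p z K : {poly R[i]} :=
  \sum_(0 <= k < K.+1) z ^+ k *: invpow M p (2^-1 + k%:R).

Lemma coef_half_part p z K j : z != 0 -> (j < M)%N ->
  (half_part p z K)`_j
  = 'C(p + j - 1, j)%:R * ((-1) ^+ j * (z^-1 * ti_part K.+1 (p + j) z)).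
Proof.
move=> z0 jM; rewrite coef_sum /ti_part big_add1 /= !mulr_sumr.
apply: eq_bigr => k _; rewrite coefZ coef_invpow // natrS_half [2^-1 + _]addrC exprS.
by field; rewrite z0 ?expf_neq0 ?half_natrD_neq0.
Qed.

Definition half_part_twosided z N : {poly R[i]} :=
  half_part 1 z N + \sum_(1 <= k < N.+1) z^-1 ^+ k *: invpow M 1 (2^-1 - k%:R).

(** From 1/2 the pole at - k is at distance (k + 1) - 1/2 and the pole at k at distance k - 1/2. The
    index shift on the first side alone causes the lengths N + 1 and N, and the factor [z^-1] in
    front of the first sum only. *)
Lemma coef_half_part_twosided z N j : z != 0 -> (j < M)%N ->
  (half_part_twosided z N)`_j
  = (-1) ^+ j * (z^-1 * ti_part N.+1 j.+1 z) - ti_part N j.+1 z^-1.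
Proof.
move=> z0 jM; rewrite coefD coef_half_part // add1n subn1 /= binn mul1r.
congr (_ + _); rewrite coef_sum /ti_part -sumrN; apply: eq_bigr => k _.
rewrite coefZ -[_ - k%:R]opprB coef_invpowN // add1n subn1 /= binn expr1.
by rewrite mulr1 mulN1r mulrN.
Qed.

End Local.

(** Up to a binomial, the coefficient of order [k] in the regular part of phi_K(s; p, z) at s = - n;
    [beta] is its analogue for Phi_N, where all poles are simple and the binomial is 1. *)
Definition alpha p z k K n : R[i] :=
  (-1) ^+ k * zeta (K - n) (k + p) z + (-1) ^+ p * zeta n (k + p) z^-1.

Definition beta z k N n : R[i] :=
  (-1) ^+ k * zeta (N - n) k.+1 z - zeta (N + n) k.+1 z^-1.

(** The residue at s = - n without the factors X^n and (-1)^q. The five summands are sorted by the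
    kernels that contribute their regular part: none, one phi, Phi, both phi, Phi and one phi. In
    the sums over sigma it is the kernel of [pb] that does so, that of [pa] giving its principal
    part. *)
Definition local_residue p1 p2 q (x x1 x2 : R[i]) K N n : R[i] :=
  let u r := (n%:R + 2^-1) ^- r in
  'C(q + p1 + p2 - 1, q - 1)%:R * u (q + p1 + p2)%N
  + sum_sigma p1 x1 p2 x2 (fun pa xa pb xb =>
      \sum_(k < pa.+1) 'C(k + pb - 1, pb - 1)%:R * 'C(q + pa - k - 1, q - 1)%:R
        * (u (q + pa - k)%N * alpha pb xb k K n))
  + \sum_(k < p1 + p2) 'C(q + p1 + p2 - k - 2, q - 1)%:R
      * (u (q + p1 + p2 - k - 1)%N * beta x k N n)
  + u q * (alpha p1 x1 0 K n * alpha p2 x2 0 K n)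
  + sum_sigma p1 x1 p2 x2 (fun pa xa pb xb =>
      \sum_(k1 < pa) \sum_(k2 < pa | (k1 + k2 <= pa - 1)%N)
        'C(k2 + pb - 1, pb - 1)%:R * 'C(q + pa - k1 - k2 - 2, q - 1)%:R
        * (u (q + pa - k1 - k2 - 1)%N * (beta x k1 N n * alpha pb xb k2 K n))).

Lemma bin_flip p j : (0 < p)%N -> 'C(p + j - 1, j) = 'C(j + p - 1, p - 1).
Proof. by move=> p0; rewrite addnC -bin_sub; [congr 'C(_, _)|]; lia. Qed.

Lemma coef_regular_alpha M p z K n j : (0 < p)%N -> (j < M)%N ->
  (regular_part M p z (K - n) n)`_j = 'C(j + p - 1, p - 1)%:R * alpha p z j K n.
Proof.
by move=> p0 jM; rewrite coef_regular_part // bin_flip // /alpha addnC.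
Qed.

Lemma coef_regular_beta M z N n j : (j < M)%N ->
  (regular_part M 1 z (N - n) (N + n))`_j = beta z j N n.
Proof.
move=> jM; rewrite coef_regular_part // add1n subn1 binn mul1r.
by rewrite expr1 mulN1r.
Qed.

Lemma coef_invpow_half M q n j : (0 < q)%N -> (j < M)%N ->
  (invpow M q (- n%:R - 2^-1 : R[i]))`_j
  = (-1) ^+ q * ('C(q + j - 1, q - 1)%:R * (n%:R + 2^-1) ^- (q + j)).
Proof.
move=> q0 jM; rewrite -opprD coef_invpowN // bin_flip // mulrA.
by congr (_ * _%:R * _); rewrite addnC.
Qed.

Lemma local_residueE M p1 p2 q (x x1 x2 : R[i]) K N n :
  (0 < p1)%N -> (0 < p2)%N -> (0 < q)%N -> (p1 + p2 < M)%N ->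
  (x ^+ n *: (1 + 'X * regular_part M 1 x (N - n) (N + n))
   * (x1 ^+ n *: (1 + 'X^p1 * regular_part M p1 x1 (K - n) n))
   * (x2 ^+ n *: (1 + 'X^p2 * regular_part M p2 x2 (K - n) n))
   * ('X^q * invpow M q (- n%:R - 2^-1)))`_(p1 + p2 + q)
  = (-1) ^+ q * ((x * x1 * x2) ^+ n * local_residue p1 p2 q x x1 x2 K N n).
Proof.
move=> p10 p20 q0 pM.
set A := regular_part _ 1 _ _ _; set B1 := regular_part _ p1 _ _ _.
set B2 := regular_part _ p2 _ _ _; set G := invpow _ _ _.
have -> : x ^+ n *: (1 + 'X * A) * (x1 ^+ n *: (1 + 'X^p1 * B1))
    * (x2 ^+ n *: (1 + 'X^p2 * B2)) * ('X^q * G)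
  = (x * x1 * x2) ^+ n *:
    ('X^q * ((1 + 'X * A) * (1 + 'X^p1 * B1) * (1 + 'X^p2 * B2) * G)).
  by rewrite -!mul_polyC !exprMn !polyCM; ring.
rewrite coefZ coefXnM ifF; last lia.
rewrite addnK coef_mul_principal // [RHS]mulrCA; congr (_ * _).
have dist (s a b c d e : R[i]) :
  s * (a + b + c + d + e) = s * a + s * b + s * c + s * d + s * e by ring.
rewrite /local_residue {}dist; congr (_ + _ + _ + _ + _).
- rewrite coef_invpow_half // mulrA.
  by rewrite -mulrA; congr (_ * ('C(_ , _)%:R * _ ^- _)); lia.
- have e pa pb xb : (0 < pb)%N -> (pa < M)%N ->
    (regular_part M pb xb (K - n) n * G)`_pa = (-1) ^+ q *
     \sum_(k < pa.+1) 'C(k + pb - 1, pb - 1)%:R * 'C(q + pa - k - 1, q - 1)%:R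
        * ((n%:R + 2^-1) ^- (q + pa - k) * alpha pb xb k K n).
    move=> pb0 paM; rewrite coefM mulr_sumr; apply: eq_bigr => -[k /= kp] _.
    rewrite coef_regular_alpha //; last lia.
    rewrite coef_invpow_half //; last lia.
    by rewrite addnBA //; ring.
  by rewrite /sum_sigma mulrDr !e //; lia.
- rewrite coefM mulr_sumr prednK; last lia.
  apply: eq_bigr => -[k /= kp] _.
  rewrite coef_regular_beta; last lia.
  rewrite coef_invpow_half //; last lia.
  rewrite (_ : (q + ((p1 + p2).-1 - k) = q + p1 + p2 - k - 1)%N); last lia.
  rewrite (_ : (q + p1 + p2 - k - 1 - 1 = q + p1 + p2 - k - 2)%N); last lia.
  ring.
- rewrite !coef0M !coef_regular_alpha //; try lia.
  rewrite coef_invpow_half //; last lia.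
  by rewrite !add0n !addn0 !binn; ring.
- have e pa pb xb : (0 < pa)%N -> (0 < pb)%N -> (pa < M)%N ->
    (A * (regular_part M pb xb (K - n) n * G))`_pa.-1 = (-1) ^+ q *
     \sum_(k1 < pa) \sum_(k2 < pa | (k1 + k2 <= pa - 1)%N)
        'C(k2 + pb - 1, pb - 1)%:R * 'C(q + pa - k1 - k2 - 2, q - 1)%:R
        * ((n%:R + 2^-1) ^- (q + pa - k1 - k2 - 1)
           * (beta x k1 N n * alpha pb xb k2 K n)).
    move=> pa0 pb0 paM; rewrite coefM mulr_sumr prednK //.
    apply: eq_bigr => -[k1 /= k1p] _.
    rewrite coef_regular_beta; last lia.
    rewrite coefM !mulr_sumr.
    rewrite (eq_bigl (fun k2 : 'I_pa => (k2 < (pa.-1 - k1).+1)%N)); last first.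
      by move=> k2 /=; lia.
    rewrite -(big_ord_widen pa (fun k2 => (-1) ^+ q *
      ('C(k2 + pb - 1, pb - 1)%:R * 'C(q + pa - k1 - k2 - 2, q - 1)%:R
        * ((n%:R + 2^-1) ^- (q + pa - k1 - k2 - 1)
           * (beta x k1 N n * alpha pb xb k2 K n))))); last lia.
    apply: eq_bigr => -[k2 /= k2p] _.
    rewrite coef_regular_alpha //; last lia.
    rewrite coef_invpow_half //; last lia.
    rewrite (_ : (q + (pa.-1 - k1 - k2) = q + pa - k1 - k2 - 1)%N); last lia.
    rewrite (_ : (q + pa - k1 - k2 - 1 - 1 = q + pa - k1 - k2 - 2)%N); last lia.
    ring.
  by rewrite /sum_sigma mulrDr !e //; lia.
Qed.

Definition centers N : seq R[i] :=
  [seq - n%:R | n <- index_iota 0 N.+1]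
  ++ [seq m.+1%:R | m <- index_iota 0 N] ++ [:: 2^-1].

Lemma centers_uniq N : uniq (centers N).
Proof.
have pos (y : R[i]) : 0 < y -> y \notin [seq - n%:R | n <- index_iota 0 N.+1].
  move=> y0; apply/mapP => -[n _ e]; move: y0; rewrite e.
  by rewrite oppr_gt0 ltrn0.
rewrite /centers cat_uniq; apply/and3P; split.
- rewrite map_inj_uniq ?iota_uniq // => m n /oppr_inj /eqP.
  by rewrite eqr_nat => /eqP.
- rewrite -all_predC all_cat all_seq1; apply/andP; split.
    by apply/allP => y /mapP[m _ ->]; apply: pos; rewrite ltr0n.
  by apply: pos; rewrite invr_gt0 ltr0n.
rewrite cats1 rcons_uniq map_inj_uniq ?iota_uniq ?andbT; last first.
  by move=> m n /eqP; rewrite eqr_nat => /eqP[].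
by apply/mapP => -[m _ e]; have := half_neq_nat m.+1; rewrite e eqxx.
Qed.

Lemma sum_centers N (f : R[i] -> R[i]) :
  \sum_(d <- centers N) f d
  = \sum_(0 <= n < N.+1) f (- n%:R) + \sum_(0 <= m < N) f m.+1%:R + f 2^-1.
Proof. by rewrite !big_cat !big_map big_seq1 /= addrA. Qed.

Lemma half_center_neq0 n : (- n%:R - 2^-1 : R[i]) != 0.
Proof. by rewrite -opprD oppr_eq0 half_natrD_neq0. Qed.

Lemma finite_identity p1 p2 q (x x1 x2 : R[i]) K N : (K <= N)%N ->
  (0 < p1)%N -> (0 < p2)%N -> (0 < q)%N ->
  x != 0 -> x1 != 0 -> x2 != 0 -> let X := x * x1 * x2 in
  \sum_(0 <= m < N) X^-1 ^+ m.+1 / (m%:R + 2^-1) ^+ q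
     * ((zeta (K + m.+1) p1 x1 - zeta m p1 x1)
        * (zeta (K + m.+1) p2 x2 - zeta m p2 x2))
  + (-1) ^+ q * (\sum_(0 <= n < K.+1) X ^+ n * local_residue p1 p2 q x x1 x2 K N n)
  + (-1) ^+ q * (\sum_(K.+1 <= n < N.+1) X ^+ n / (n%:R + 2^-1) ^+ q
     * ((-1) ^+ p1 * (zeta n p1 x1^-1 - zeta (n - K.+1) p1 x1^-1)
        * ((-1) ^+ p2 * (zeta n p2 x2^-1 - zeta (n - K.+1) p2 x2^-1))))
  + \sum_(k1 < q) \sum_(k2 < q) \sum_(k3 < q | (k1 + k2 + k3 == q - 1)%N)
      ((-1) ^+ k1 * (x^-1 * ti_part N.+1 k1.+1 x) - ti_part N k1.+1 x^-1)
      * ('C(k2 + p1 - 1, p1 - 1)%:R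
         * ((-1) ^+ k2 * (x1^-1 * ti_part K.+1 (k2 + p1) x1)))
      * ('C(k3 + p2 - 1, p2 - 1)%:R
         * ((-1) ^+ k3 * (x2^-1 * ti_part K.+1 (k3 + p2) x2)))
  = 0.
Proof.
(* The product has 1 + p1 + p2 + q simple factors, so its residue is the coefficient of index p1 +
   p2 + q; this [M] is the least truncation that retains it. *)
move=> KN p10 p20 q0 x0 x10 x20 X; pose M := (p1 + p2 + q).+1.
pose Ph (d : R[i]) := \sum_(0 <= k < N.+1) x ^+ k *: pole M 1 (d - - k%:R)
  + \sum_(1 <= k < N.+1) x^-1 ^+ k *: pole M 1 (d - k%:R).
pose ph p z (d : R[i]) := \sum_(0 <= k < K.+1) z ^+ k *: pole M p (d - - k%:R).
have Dneg k : (k <= N)%N -> - k%:R \in centers N.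
  move=> kN; rewrite mem_cat; apply/orP; left; apply/mapP; exists k => //.
  by rewrite mem_index_iota.
have Dpos k : (0 < k <= N)%N -> k%:R \in centers N.
  case: k => // k /andP[_ kN]; rewrite !mem_cat; apply/orP; right; apply/orP; left.
  by apply/mapP; exists k => //; rewrite mem_index_iota.
have Dhalf : 2^-1 \in centers N by rewrite !mem_cat mem_seq1 eqxx !orbT.
have total : \sum_(d <- centers N)
    (Ph d * ph p1 x1 d * ph p2 x2 d * pole M q (d - 2^-1))`_(p1 + p2 + q) = 0.
  have DK j : j \in index_iota 0 K.+1 -> - j%:R \in centers N.
    by rewrite mem_index_iota => hj; apply: Dneg; lia.
  rewrite -[RHS]addr0.
  (* The zero on the right is split in two, one for each half of Phi_N: poles at - k, then poles at
     k. *)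
  rewrite -[X in _ = X + _](@sum_residues_lin _ M _ _ (centers N) 2^-1 p1 p2 q
    (index_iota 0 N.+1) (fun k => x ^+ k) (fun k => - k%:R)
    (index_iota 0 K.+1) (index_iota 0 K.+1) (fun k => x1 ^+ k) (fun k => x2 ^+ k)
    (fun k => - k%:R) (fun k => - k%:R)) ?centers_uniq //; last 2 first.
  - by move=> k; rewrite mem_index_iota => hk; apply: Dneg; lia.
  - by rewrite /M; lia.
  rewrite -[X in _ = _ + X](@sum_residues_lin _ M _ _ (centers N) 2^-1 p1 p2 q
    (index_iota 1 N.+1) (fun k => x^-1 ^+ k) (fun k => k%:R)
    (index_iota 0 K.+1) (index_iota 0 K.+1) (fun k => x1 ^+ k) (fun k => x2 ^+ k)
    (fun k => - k%:R) (fun k => - k%:R)) ?centers_uniq //; last 2 first.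
  - by move=> k; rewrite mem_index_iota => hk; apply: Dpos; lia.
  - by rewrite /M; lia.
  by rewrite -big_split; apply: eq_bigr => d _; rewrite /= -coefD -!mulrDl.
have phE p z d : (forall k, (k <= K)%N -> d + k%:R != 0) ->
    ph p z d = 'X^p * \sum_(0 <= k < K.+1) z ^+ k *: invpow M p (d + k%:R).
  exact: sum_pole_far.
have res_half : (Ph 2^-1 * ph p1 x1 2^-1 * ph p2 x2 2^-1
      * pole M q (2^-1 - 2^-1))`_(p1 + p2 + q)
  = \sum_(k1 < q) \sum_(k2 < q) \sum_(k3 < q | (k1 + k2 + k3 == q - 1)%N)
      ((-1) ^+ k1 * (x^-1 * ti_part N.+1 k1.+1 x) - ti_part N k1.+1 x^-1)
      * ('C(k2 + p1 - 1, p1 - 1)%:R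
         * ((-1) ^+ k2 * (x1^-1 * ti_part K.+1 (k2 + p1) x1)))
      * ('C(k3 + p2 - 1, p2 - 1)%:R
         * ((-1) ^+ k3 * (x2^-1 * ti_part K.+1 (k3 + p2) x2))).
  have hk k : 2^-1 + k%:R != 0 :> R[i] by rewrite addrC half_natrD_neq0.
  have -> : Ph 2^-1 = 'X * half_part_twosided M x N.
    rewrite /Ph sum_pole_far // expr1 mulrDr; congr (_ + _).
    rewrite mulr_sumr; apply: eq_bigr => k _.
    by rewrite pole_neq0 ?scalerAr // -oppr_eq0 opprB half_natrB_neq0.
  rewrite !phE // subrr pole00 mulr1.
  rewrite -[in LHS]/(half_part M p1 x1 K) -[in LHS]/(half_part M p2 x2 K).
  set H := half_part_twosided _ _ _; set H1 := half_part _ _ _ _.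
  set H2 := half_part _ _ _ _.
  (* No kernel has a pole at 1/2, so only 1/(s - 1/2)^q is singular there and the coefficient of
     order q - 1 of the kernels is wanted: hence the constraint k1 + k2 + k3 = q - 1. *)
  have -> : 'X * H * ('X^p1 * H1) * ('X^p2 * H2)
    = 'X^(1 + p1 + p2) * (H * (H1 * H2)) by rewrite !exprD; ring.
  rewrite coefXnM ifF; last lia.
  rewrite (_ : (p1 + p2 + q - (1 + p1 + p2) = q.-1)%N); last lia.
  rewrite -(sum_compositions3 (fun k1 k2 k3 =>
      ((-1) ^+ k1 * (x^-1 * ti_part N.+1 k1.+1 x) - ti_part N k1.+1 x^-1)
      * ('C(k2 + p1 - 1, p1 - 1)%:R
         * ((-1) ^+ k2 * (x1^-1 * ti_part K.+1 (k2 + p1) x1)))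
      * ('C(k3 + p2 - 1, p2 - 1)%:R
         * ((-1) ^+ k3 * (x2^-1 * ti_part K.+1 (k3 + p2) x2))))) //.
  rewrite coefM prednK //; apply: eq_bigr => -[k1 /= k1q] _.
  rewrite coef_half_part_twosided //; last by rewrite /M; lia.
  rewrite coefM mulr_sumr; apply: eq_bigr => -[k2 /= k2q] _.
  rewrite !coef_half_part //; try by rewrite /M; lia.
  rewrite !bin_flip // [(p1 + k2)%N]addnC [(p2 + _)%N]addnC.
  by rewrite mulrA.
have res_pos m : (m < N)%N ->
    (Ph m.+1%:R * ph p1 x1 m.+1%:R * ph p2 x2 m.+1%:R
      * pole M q (m.+1%:R - 2^-1))`_(p1 + p2 + q)
  = X^-1 ^+ m.+1 / (m%:R + 2^-1) ^+ q
     * ((zeta (K + m.+1) p1 x1 - zeta m p1 x1)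
        * (zeta (K + m.+1) p2 x2 - zeta m p2 x2)).
  move=> mN; have hk k : m.+1%:R + k%:R != 0 :> R[i].
    by rewrite -natrD pnatr_eq0.
  rewrite !phE // pole_neq0 ?half_natrB_neq0 // coef_mulX4.
  rewrite coef0_invpow // !sum_far_pos // natrS_half.
  (* A single term of Phi_N has its pole here; all others carry a factor ['X]. *)
  have -> : (Ph m.+1%:R)`_0 = x^-1 ^+ m.+1.
    rewrite /Ph sum_pole_far // coefD expr1 coefXM add0r coef_sum.
    rewrite (bigD1_seq m.+1) ?mem_index_iota ?iota_uniq //=.
    rewrite subrr pole00 coefZ coef1 mulr1 big1 ?addr0 // => k km.
    by rewrite pole_neq0 ?natrB_neq0 1?eq_sym // coefZ expr1 coefXM mulr0.
  by rewrite /X !invfM !exprMn; ring.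
have res_neg n : (n <= K)%N ->
    (Ph (- n%:R) * ph p1 x1 (- n%:R) * ph p2 x2 (- n%:R)
      * pole M q (- n%:R - 2^-1))`_(p1 + p2 + q)
  = (-1) ^+ q * (X ^+ n * local_residue p1 p2 q x x1 x2 K N n).
  move=> nK; rewrite /Ph /ph sum_pole_twosided_at ?sum_pole_at //; last lia.
  rewrite pole_neq0 ?half_center_neq0 // local_residueE //.
  by rewrite /M; lia.
have res_far n : (K < n <= N)%N ->
    (Ph (- n%:R) * ph p1 x1 (- n%:R) * ph p2 x2 (- n%:R)
      * pole M q (- n%:R - 2^-1))`_(p1 + p2 + q)
  = (-1) ^+ q * (X ^+ n / (n%:R + 2^-1) ^+ q
     * ((-1) ^+ p1 * (zeta n p1 x1^-1 - zeta (n - K.+1) p1 x1^-1)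
        * ((-1) ^+ p2 * (zeta n p2 x2^-1 - zeta (n - K.+1) p2 x2^-1)))).
  move=> /andP[Kn nN]; have hk k : (k <= K)%N -> - n%:R + k%:R != 0 :> R[i].
    by move=> kK; rewrite addrC natrB_neq0 //; lia.
  rewrite !phE // pole_neq0 ?half_center_neq0 // coef_mulX4 !sum_far_neg //.
  have -> : (Ph (- n%:R))`_0 = x ^+ n.
    by rewrite /Ph sum_pole_twosided_at // coefZ coefD coef1 coefXM addr0 mulr1.
  rewrite coef_invpow_half // addn0 binn mul1r /X !exprMn.
  ring.
move: total; rewrite sum_centers (@big_cat_nat _ _ _ K.+1 0 N.+1) //=.
rewrite res_half (eq_big_nat _ _ (fun n h => res_neg n _)) //.
rewrite (eq_big_nat _ _ (fun n h => res_far n _)) //.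
rewrite (eq_big_nat _ _ (fun m h => res_pos m _)) //; last first.
rewrite -!mulr_sumr => total; rewrite -[RHS]total; ring.
Qed.

End FiniteIdentity.

(** * Limits of complex sequences *)

Section Modulus.
Local Open Scope classical_set_scope.
Variable R : realType.
Implicit Types (z w l : R[i]) (u v : nat -> R[i]).

(** The norm of [R[i]] takes its values in [R[i]]; its real part moves all estimates and limits to
    [R]. *)
Definition cabs z : R := complex.Re `|z|.

Lemma normE z : `|z| = (cabs z)%:C.
Proof. by rewrite /cabs RRe_real // normr_real. Qed.

Lemma cabs_of_norm z (r : R) : `|z| = r%:C -> cabs z = r.
Proof. by rewrite /cabs => ->. Qed.

Lemma cabs_ge0 z : 0 <= cabs z.
Proof. by rewrite -lecR -normE normr_ge0. Qed.

Lemma cabsD z w : cabs (z + w) <= cabs z + cabs w.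
Proof. by rewrite -lecR rmorphD /= -!normE ler_normD. Qed.

Lemma cabsN z : cabs (- z) = cabs z.
Proof. by rewrite /cabs normrN. Qed.

Lemma cabsC z w : cabs (z - w) = cabs (w - z).
Proof. by rewrite /cabs distrC. Qed.

Lemma cabsB z w : cabs (z - w) <= cabs z + cabs w.
Proof. by rewrite -[cabs w]cabsN cabsD. Qed.

Lemma cabsM z w : cabs (z * w) = cabs z * cabs w.
Proof. by apply: cabs_of_norm; rewrite normrM !normE rmorphM. Qed.

Lemma cabsV z : cabs z^-1 = (cabs z)^-1.
Proof. by apply: cabs_of_norm; rewrite normfV normE fmorphV. Qed.

Lemma cabsX z n : cabs (z ^+ n) = cabs z ^+ n.
Proof. by apply: cabs_of_norm; rewrite normrX normE rmorphXn. Qed.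

Lemma cabs0 : cabs 0 = 0. Proof. by rewrite /cabs normr0. Qed.

Lemma cabs1 : cabs 1 = 1. Proof. by rewrite /cabs normr1. Qed.

Lemma cabs_eq0 z : (cabs z == 0) = (z == 0).
Proof.
apply/eqP/eqP => [h|->]; last exact: cabs0.
by apply/eqP; rewrite -normr_eq0 normE h.
Qed.

Lemma cabs_real (r : R) : 0 <= r -> cabs r%:C = r.
Proof. by move=> r0; apply: cabs_of_norm; rewrite ger0_norm // lecR. Qed.

Lemma cabs_nat n : cabs n%:R = n%:R.
Proof. by rewrite -(rmorph_nat (real_complex R)) /= cabs_real. Qed.

Lemma cabs_sign n : cabs ((-1) ^+ n) = 1.
Proof. by rewrite cabsX cabsN cabs1 expr1n. Qed.

Lemma cabs_sum (I : Type) (r : seq I) (P : pred I) (F : I -> R[i]) :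
  cabs (\sum_(i <- r | P i) F i) <= \sum_(i <- r | P i) cabs (F i).
Proof.
elim/big_ind2: _ => [|x1 x2 y1 y2 h1 h2|//]; first by rewrite cabs0.
by rewrite (le_trans (cabsD _ _)) // lerD.
Qed.

Lemma cabs_natD_half n : cabs (n%:R + 2^-1) = n%:R + 2^-1.
Proof.
have -> : n%:R + 2^-1 = (n%:R + 2^-1 : R)%:C.
  by rewrite rmorphD fmorphV /= !rmorph_nat.
by rewrite cabs_real // addr_ge0 // invr_ge0.
Qed.

Lemma cabs_root_of_unity z : is_root_of_unity z -> cabs z = 1.
Proof.
move=> [n n0 /unity_rootP zn]; have : cabs z ^+ n = 1 by rewrite -cabsX zn cabs1.
by move/eqP; rewrite pexpr_eq1 // ?cabs_ge0 // => /eqP.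
Qed.

Lemma re_le_cabs z : `|complex.Re z| <= cabs z.
Proof. by rewrite -lecR -normE normc_ge_Re. Qed.

Lemma im_le_cabs z : `|complex.Im z| <= cabs z.
Proof.
have -> : complex.Im z = - complex.Re (z * 'i) by rewrite ReiNIm opprK.
rewrite normrN (le_trans (re_le_cabs _)) // cabsM.
suff -> : cabs 'i = 1 by rewrite mulr1.
by apply: cabs_of_norm; rewrite normc_def /= expr0n expr1n add0r sqrtr1.
Qed.

Lemma cabs_le_re_im z : cabs z <= `|complex.Re z| + `|complex.Im z|.
Proof.
rewrite {1}[z]complexE (le_trans (cabsD _ _)) // cabsM.
have -> : cabs 'i = 1.
  by apply: cabs_of_norm; rewrite normc_def /= expr0n expr1n add0r sqrtr1.
have e (r : R) : cabs r%:C = `|r|.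
  by apply: cabs_of_norm; rewrite normc_def /= expr0n addr0 sqrtr_sqr.
by rewrite mul1r !e.
Qed.

Definition ctends u l := (fun n => cabs (u n - l)) @ \oo --> (0 : R).

Lemma ctends_le u l (b : nat -> R) :
  (forall n, cabs (u n - l) <= b n) -> b @ \oo --> (0 : R) -> ctends u l.
Proof.
move=> h b0; apply: (@squeeze_cvgr _ _ _ _ (cst 0) b) => //; last exact: cvg_cst.
by apply: nearW => n; rewrite cabs_ge0 h.
Qed.

Lemma ctends_cst l : ctends (fun=> l) l.
Proof. by rewrite /ctends subrr cabs0; exact: cvg_cst. Qed.

Lemma ctendsD u v l m : ctends u l -> ctends v m -> ctends (fun n => u n + v n) (l + m).
Proof.
move=> ul vm; apply: (ctends_le (b := fun n => cabs (u n - l) + cabs (v n - m))).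
  by move=> n; rewrite opprD addrACA cabsD.
by rewrite -[0 in X in _ --> X](addr0 0); exact: cvgD ul vm.
Qed.

Lemma ctendsM u v l m : ctends u l -> ctends v m -> ctends (fun n => u n * v n) (l * m).
Proof.
move=> ul vm.
apply: (ctends_le (b := fun n => cabs (u n - l) * (cabs (v n - m) + cabs m)
  + cabs l * cabs (v n - m))).
  move=> n; have -> : u n * v n - l * m = (u n - l) * v n + l * (v n - m) by ring.
  rewrite (le_trans (cabsD _ _)) // !cabsM lerD2r ler_wpM2l ?cabs_ge0 //.
  by rewrite -{1}(subrK m (v n)) cabsD.
have -> : 0 = 0 * (0 + cabs m) + cabs l * 0 :> R by ring.
apply: cvgD; last by apply: cvgM vm; exact: cvg_cst.
by apply: cvgM ul _; apply: cvgD vm _; exact: cvg_cst.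
Qed.

Lemma ctendsZ c u l : ctends u l -> ctends (fun n => c * u n) (c * l).
Proof. by apply: ctendsM; exact: ctends_cst. Qed.

Lemma ctendsN u l : ctends u l -> ctends (fun n => - u n) (- l).
Proof.
move=> ul; have := ctendsZ (-1) ul; rewrite mulN1r.
by congr (ctends _ _); apply/funext => n; rewrite mulN1r.
Qed.

Lemma ctendsB u v l m : ctends u l -> ctends v m -> ctends (fun n => u n - v n) (l - m).
Proof. by move=> ul vm; apply: ctendsD ul (ctendsN vm). Qed.

Lemma ctends_sum (I : Type) (r : seq I) (P : pred I) (F : I -> nat -> R[i])
    (L : I -> R[i]) : (forall i, P i -> ctends (F i) (L i)) ->
  ctends (fun n => \sum_(i <- r | P i) F i n) (\sum_(i <- r | P i) L i).
Proof.
move=> h; elim: r => [|i r IH].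
  by rewrite big_nil; under eq_fun do rewrite big_nil; exact: ctends_cst.
rewrite big_cons; under eq_fun do rewrite big_cons.
by case: ifP => // Pi; apply: ctendsD => //; apply: h.
Qed.

Lemma ctends_unique u l m : ctends u l -> ctends u m -> l = m.
Proof.
move=> ul um; apply/eqP; rewrite -subr_eq0 -cabs_eq0; apply/eqP.
have := ctendsB ul um; under [X in ctends X]eq_fun do rewrite subrr.
rewrite /ctends sub0r cabsN => /cvg_lim <- //.
by apply/esym/cvg_lim => //; exact: cvg_cst.
Qed.

Lemma ctends_comp u l (phi : nat -> nat) : (forall n, (n <= phi n)%N) ->
  ctends u l -> ctends (fun n => u (phi n)) l.
Proof.
move=> hphi ul; apply: (cvg_comp phi _ _ ul).
move=> A [N _ NA]; exists N => // n /= Nn; apply: NA => /=.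
exact: leq_trans Nn (hphi n).
Qed.

(** A positive element of [R[i]] is real, so the epsilon condition for the topology of [R[i]^o] is
    the one on the real modulus. *)
Lemma ctends_csum u l : ctends (fun N => \sum_(0 <= n < N) u n) l -> csum u = l.
Proof.
move=> ul; rewrite /csum; apply: (@cvg_lim R[i]^o) => //.
apply/cvgrPdistC_lt => e e0.
have Re0 : 0 < complex.Re e by move: e0; rewrite ltcE => /andP[].
have eR : e = (complex.Re e)%:C by rewrite RRe_real // gtr0_real.
move/cvgrPdist_lt: ul => /(_ _ Re0); apply: filterS => n.
rewrite sub0r normrN ger0_norm ?cabs_ge0 // => h.
by rewrite eR -[X in `|X|]/(_ - _ : R[i]) normE ltcR seriesEnat.
Qed.

Lemma ctends_harmonic_bound u l (C : R) :
  (forall n, cabs (u n - l) <= C / n.+1%:R) -> ctends u l.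
Proof.
move=> h; apply: ctends_le h _; rewrite -(mulr0 C).
by apply: cvgM; [exact: cvg_cst | exact: cvg_harmonic].
Qed.

Lemma real_cauchy_cvg (f : nat -> R) (C : R) :
  (forall a b, (a <= b)%N -> `|f b - f a| <= C / a.+1%:R) ->
  exists l : R, f @ \oo --> l.
Proof.
move=> h; suff : cvg (f @ \oo) by move=> /cvg_ex.
apply/cauchy_cvgP/cauchy_ballP => e e0; near_simpl.
have : (fun n => C / n.+1%:R) @ \oo --> (0 : R).
  by rewrite -(mulr0 C); apply: cvgM; [exact: cvg_cst | exact: cvg_harmonic].
move=> /cvgrPdist_lt /(_ _ e0) [N _ hN].
have key a b : (N <= a)%N -> (a <= b)%N -> `|f b - f a| < e.
  move=> Na ab; apply: le_lt_trans (h _ _ ab) _.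
  by apply: le_lt_trans (hN _ Na); rewrite sub0r normrN ler_norm.
near=> n m => /=; rewrite /ball /=.
have Nn : (N <= n)%N by near: n; exists N.
have Nm : (N <= m)%N by near: m; exists N.
case/orP: (leq_total n m) => nm; last exact: key.
by rewrite distrC; apply: key.
Unshelve. all: by end_near. Qed.

Lemma ctends_cauchy u (C : R) :
  (forall a b, (a <= b)%N -> cabs (u b - u a) <= C / a.+1%:R) ->
  exists2 l, ctends u l & forall a, cabs (u a - l) <= C / a.+1%:R.
Proof.
move=> h.
have [lr ulr] : exists l : R, (fun n => complex.Re (u n)) @ \oo --> l.
  apply: (@real_cauchy_cvg _ C) => a b ab; apply: le_trans (h _ _ ab).
  have -> : complex.Re (u b) - complex.Re (u a) = complex.Re (u b - u a).
    by case: (u b) (u a) => ? ? [].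
  exact: re_le_cabs.
have [li uli] : exists l : R, (fun n => complex.Im (u n)) @ \oo --> l.
  apply: (@real_cauchy_cvg _ C) => a b ab; apply: le_trans (h _ _ ab).
  have -> : complex.Im (u b) - complex.Im (u a) = complex.Im (u b - u a).
    by case: (u b) (u a) => ? ? [].
  exact: im_le_cabs.
have ul : ctends u (Complex lr li).
  apply: (ctends_le (b := fun n => `|complex.Re (u n) - lr| + `|complex.Im (u n) - li|)).
    by move=> n; apply: le_trans (cabs_le_re_im _) _; case: (u n).
  rewrite -(addr0 0); apply: cvgD.
    by apply/norm_cvg0P; rewrite -(subrr lr); apply: cvgB ulr _; exact: cvg_cst.
  by apply/norm_cvg0P; rewrite -(subrr li); apply: cvgB uli _; exact: cvg_cst.
exists (Complex lr li) => // a.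
have lim : (fun n => cabs (u n - Complex lr li) + C / a.+1%:R) @ \oo --> C / a.+1%:R.
  by rewrite -[X in _ --> X]add0r; apply: cvgD ul _; exact: cvg_cst.
(* The rate is inherited by the limit: the upper index in the Cauchy estimate is sent to
   infinity. *)
apply: (@cvgr_to_ge _ _ _ _ _ _ _ lim); near=> n.
have -> : u a - Complex lr li = (u n - Complex lr li) + (u a - u n) by ring.
apply: le_trans (cabsD _ _) _; apply: lerD => //.
by rewrite cabsC; apply: h; near: n; exists a.
Unshelve. all: by end_near. Qed.

End Modulus.

(** * Estimates of partial sums *)

Section Estimates.
Variable R : realType.
Implicit Types (z l d : R[i]) (u v w : nat -> R[i]) (C : R).

(** Telescoping of 1/t^2 <= 2/t - 2/(t + 1) for t >= 1, with equality at t = 1, whence the constant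
    2. *)
Lemma sum_inv_square_le a b :
  \sum_(a <= n < b) (n.+1%:R ^- 2 : R) <= 2 / a.+1%:R.
Proof.
have [ba|/ltnW ab] := leqP b a; first by rewrite big_geq.
suff h : \sum_(a <= n < b) (n.+1%:R ^- 2 : R) <= 2 / a.+1%:R - 2 / b.+1%:R.
  by apply: le_trans h _; rewrite gerBl divr_ge0.
elim: b ab => [|b IH]; first by rewrite leqn0 => /eqP->; rewrite big_geq // subrr.
rewrite leq_eqVlt => /orP[/eqP->|ab]; first by rewrite big_geq // subrr.
rewrite big_nat_recr //=.
have step : (b.+1%:R ^- 2 : R) <= 2 / b.+1%:R - 2 / b.+2%:R.
  have t1 : (1 : R) <= b.+1%:R by rewrite ler1n.
  rewrite -[b.+2]addn1 natrD; move: (b.+1%:R : R) t1 => t t1.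
  rewrite -subr_ge0.
  have -> : 2 / t - 2 / (t + 1%:R) - t ^- 2 = (t - 1) / (t ^+ 2 * (t + 1)).
    by field; apply/andP; split; lra.
  by rewrite divr_ge0 ?mulr_ge0 ?exprn_ge0; lra.
by apply: le_trans (lerD (IH ab) step) _; rewrite addrA subrK.
Qed.

Lemma abel_summation z v a b : (a <= b)%N ->
  (z - 1) * \sum_(a <= n < b) z ^+ n * v n
  = z ^+ b * v b - z ^+ a * v a - \sum_(a <= n < b) z ^+ n.+1 * (v n.+1 - v n).
Proof.
move=> ab; rewrite -(telescope_sumr (fun n => z ^+ n * v n) ab) -sumrB mulr_sumr.
by apply: eq_bigr => n _; rewrite exprS; ring.
Qed.

(** By Abel summation. The 4 is 2 for the two boundary terms plus 2 from [sum_inv_square_le]. *)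
Lemma dirichlet_bound z v C : cabs z = 1 -> z != 1 ->
  (forall n, cabs (v n) <= C / n.+1%:R) ->
  (forall n, cabs (v n.+1 - v n) <= C / n.+1%:R ^+ 2) ->
  forall a b, (a <= b)%N ->
  cabs (\sum_(a <= n < b) z ^+ n * v n) <= 4 * C / cabs (z - 1) / a.+1%:R.
Proof.
move=> z1 zn1 hv hd a b ab.
have C0 : 0 <= C by have := le_trans (cabs_ge0 _) (hv 0%N); rewrite divr1.
have z0 : 0 < cabs (z - 1) by rewrite lt_neqAle cabs_ge0 eq_sym cabs_eq0 subr_eq0 zn1.
rewrite mulrAC ler_pdivlMr // mulrC -cabsM abel_summation //.
apply: le_trans (cabsB _ _) _.
have h1 : cabs (z ^+ b * v b - z ^+ a * v a) <= 2 * (C / a.+1%:R).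
  apply: le_trans (cabsB _ _) _; rewrite !cabsM !cabsX z1 !expr1n !mul1r.
  have hb : C / b.+1%:R <= C / a.+1%:R.
    by rewrite ler_wpM2l // lef_pV2 ?posrE ?ltr0n // ler_nat ltnS.
  by rewrite mulr_natl mulr2n; apply: lerD => //; exact: le_trans (hv b) hb.
have h2 : cabs (\sum_(a <= n < b) z ^+ n.+1 * (v n.+1 - v n)) <= C * (2 / a.+1%:R).
  apply: le_trans (cabs_sum _ _ _) _.
  apply: le_trans (ler_wpM2l C0 (sum_inv_square_le a b)).
  rewrite mulr_sumr; apply: ler_sum => n _.
  by rewrite cabsM cabsX z1 expr1n mul1r.
apply: le_trans (lerD h1 h2) _.
by rewrite le_eqVlt; apply/orP; left; apply/eqP; ring.
Qed.

(* Weights w for which the tails of sum_n z^n w_n / (n + d)^r are O(1/n). *)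
Definition slow w := exists C,
  forall n, cabs (w n) <= C /\ cabs (w n.+1 - w n) <= C / n.+1%:R.

Lemma slow_cst l : slow (fun=> l).
Proof.
exists (cabs l) => n; split => //.
by rewrite subrr cabs0 divr_ge0 ?cabs_ge0.
Qed.

Lemma slowM u v : slow u -> slow v -> slow (fun n => u n * v n).
Proof.
move=> [C hC] [D hD]; exists (C * D + C * D) => n.
have [u1 u2] := hC n; have [v1 v2] := hD n; have [u3 _] := hC n.+1.
have C0 := le_trans (cabs_ge0 _) u1; have D0 := le_trans (cabs_ge0 _) v1.
have CD0 : 0 <= C * D by rewrite mulr_ge0.
split; first by rewrite cabsM (le_trans (ler_pM _ _ u1 v1)) ?cabs_ge0 // lerDl.
have -> : u n.+1 * v n.+1 - u n * v n
  = u n.+1 * (v n.+1 - v n) + (u n.+1 - u n) * v n by ring.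
apply: le_trans (cabsD _ _) _; rewrite !cabsM mulrDl; apply: lerD.
  by rewrite -mulrA ler_pM ?cabs_ge0.
by rewrite mulrAC ler_pM ?cabs_ge0.
Qed.

(** Treats the denominators n + 1 of [Li] and n + 1/2 of [ti] and [Rsum] together; the constant 2 is
    attained for d = 1/2, n = 0. *)
Definition shift_ok d := forall n,
  n%:R + d != 0 /\ cabs (n%:R + d)^-1 <= 2 / n.+1%:R.

Lemma shift_ok1 : shift_ok 1.
Proof.
move=> n; rewrite natr1 pnatr_eq0; split=> //; rewrite cabsV cabs_nat.
by rewrite -[X in X <= _]mul1r ler_wpM2r ?invr_ge0 // ler1n.
Qed.

Lemma shift_ok_half : shift_ok 2^-1.
Proof.
move=> n; rewrite -cabs_eq0 cabsV cabs_natD_half.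
have n0 : (0 : R) <= n%:R by [].
split; first by apply: lt0r_neq0; lra.
rewrite -[n.+1]addn1 natrD ler_pdivlMr; last by lra.
rewrite mulrC ler_pdivrMr; lra.
Qed.

Lemma cabs_shift_pow d r n : shift_ok d -> (0 < r)%N ->
  cabs ((n%:R + d) ^- r) <= 2 ^+ r / n.+1%:R.
Proof.
move=> hd r0; rewrite -exprVn cabsX.
have /andP[t0 t1] : 0 <= (n.+1%:R : R)^-1 <= 1 by rewrite invr_ge0 ler0n invf_le1 ?ltr0n ?ler1n.
apply: le_trans (_ : (2 / n.+1%:R) ^+ r <= _).
  by rewrite lerXn2r ?nnegrE ?cabs_ge0 ?divr_ge0 //; have [] := hd n.
rewrite exprMn ler_wpM2l ?exprn_ge0 //.
by rewrite -[X in _ <= X]expr1 ler_wiXn2l.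
Qed.

Lemma slow_series z r d w : cabs z = 1 -> (0 < r)%N -> (r, z) <> (1%N, 1) ->
  shift_ok d -> slow w ->
  exists C, forall a b, (a <= b)%N ->
    cabs (\sum_(a <= n < b) z ^+ n / (n%:R + d) ^+ r * w n) <= C / a.+1%:R.
Proof.
move=> z1 r0 rz hd [W hW].
have W0 : 0 <= W by have [h _] := hW 0%N; exact: le_trans (cabs_ge0 _) h.
have [r1|r2] := leqP r 1.
  have {r0 r1} r1 : r = 1%N by lia.
  have zn1 : z != 1 by apply: contra_notN rz => /eqP->; rewrite r1.
  (* The differences of w_n / (n + d) are at most (2 W + 4 W) / (n + 1)^2, the two parts coming from
     the variation of w and of 1 / (n + d). *)
  exists (4 * (6 * W) / cabs (z - 1)) => a b ab.
  under eq_bigr do rewrite -mulrA.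
  apply: dirichlet_bound => // n; rewrite r1 expr1.
    have [_ h] := hd n; have [h' _] := hW n.
    rewrite cabsM; apply: le_trans (ler_pM _ _ h h') _; rewrite ?cabs_ge0 //.
    by rewrite mulrAC ler_wpM2r ?invr_ge0 // ; lra.
  have [y0 hy] := hd n; have [y0' hy'] := hd n.+1; have [w1 w2] := hW n.
  have -> : (n.+1%:R + d)^-1 * w n.+1 - (n%:R + d)^-1 * w n
    = (n.+1%:R + d)^-1 * (w n.+1 - w n) - (n.+1%:R + d)^-1 * (n%:R + d)^-1 * w n.
    by move: y0 y0'; rewrite -natr1 => y0 y0'; field; rewrite y0 y0'.
  have hy'' : cabs (n.+1%:R + d)^-1 <= 2 / n.+1%:R.
    apply: le_trans hy' _; rewrite ler_wpM2l // lef_pV2 ?posrE ?ltr0n //.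
    by rewrite ler_nat.
  apply: le_trans (cabsB _ _) _; rewrite !cabsM.
  have -> : 6 * W / n.+1%:R ^+ 2
    = 2 / n.+1%:R * (W / n.+1%:R) + 2 / n.+1%:R * (2 / n.+1%:R) * W :> R.
    have : (n.+1%:R : R) != 0 by rewrite pnatr_eq0.
    by move: (n.+1%:R : R) => t t0; field.
  by apply: lerD; rewrite !ler_pM ?mulr_ge0 ?cabs_ge0.
(* For r >= 2 convergence is absolute, by comparison with 1 / (n + 1)^2. *)
exists (2 ^+ r * W * 2) => a b ab.
apply: le_trans (cabs_sum _ _ _) _.
have K0 : 0 <= 2 ^+ r * W by rewrite mulr_ge0 ?exprn_ge0.
rewrite -mulrA; apply: le_trans (ler_wpM2l K0 (sum_inv_square_le a b)).
rewrite mulr_sumr; apply: ler_sum => n _.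
rewrite !cabsM cabsX z1 expr1n mul1r mulrAC.
have [w1 _] := hW n; apply: ler_pM; rewrite ?cabs_ge0 //.
have [_ h] := hd n; rewrite -[(_ + d) ^- r]exprVn cabsX.
apply: le_trans (_ : (2 / n.+1%:R) ^+ r <= _).
  by rewrite lerXn2r ?nnegrE ?cabs_ge0 ?divr_ge0.
rewrite exprMn ler_wpM2l ?exprn_ge0 // -exprVn.
by rewrite ler_wiXn2l // ?invr_ge0 ?ler0n // invf_le1 ?ltr0n ?ler1n.
Qed.

End Estimates.

(** * Series on the unit circle and partial sums of variable length *)

Section Series.
Variable R : realType.
Implicit Types (z l d y : R[i]) (u v w g : nat -> R[i]) (C : R) (f : nat -> nat -> R[i]).

(** Guarantees convergence of the series of z^n / n^p, and is stable under inverting z and raising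
    p; this is how it passes from the data to the terms of the formula. *)
Definition summable_pair p z := [/\ (0 < p)%N, cabs z = 1 & (p, z) <> (1%N, 1)].

Lemma summable_pairV p z : summable_pair p z -> summable_pair p z^-1.
Proof.
move=> [p0 z1 pz]; split=> //; first by rewrite cabsV z1 invr1.
by move=> [p1 /eqP]; rewrite invr_eq1 => /eqP e; apply: pz; rewrite p1 e.
Qed.

Lemma summable_pairD p z k : summable_pair p z -> summable_pair (k + p) z.
Proof.
move=> [p0 z1 pz]; split=> //; first lia.
by move=> [p1 e]; apply: pz; congr pair => //; lia.
Qed.

Lemma summable_pairW p r z : (p <= r)%N -> summable_pair p z -> summable_pair r z.
Proof. by move=> pr; rewrite -(subnK pr); apply: summable_pairD. Qed.

Lemma zetaE N p z : zeta N p z = \sum_(0 <= n < N) z ^+ n.+1 / n.+1%:R ^+ p.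
Proof. by rewrite /zeta big_add1. Qed.

Lemma zeta0 p z : zeta 0 p z = 0. Proof. by rewrite zetaE big_geq. Qed.

Lemma zeta_increment a b p z : (a <= b)%N -> zeta b p z - zeta a p z
  = \sum_(a <= n < b) z ^+ n.+1 / n.+1%:R ^+ p.
Proof.
by move=> ab; rewrite !zetaE (@big_cat_nat _ _ _ a 0 b) //= addDB.
Qed.

Lemma zeta_tail p z : summable_pair p z -> exists C, forall a b, (a <= b)%N ->
  cabs (zeta b p z - zeta a p z) <= C / a.+1%:R.
Proof.
move=> [p0 z1 pz].
have [C hC] := slow_series z1 p0 pz (@shift_ok1 R) (slow_cst 1).
exists C => a b ab; have := hC a b ab; congr (_ <= _).
rewrite zeta_increment // -[LHS]mul1r -z1 -cabsM mulr_sumr; congr cabs.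
by apply: eq_bigr => n _; rewrite natr1 mulr1 exprS mulrA.
Qed.

Lemma zeta_Li_bound p z : summable_pair p z -> exists C,
  forall a, cabs (zeta a p z - Li p z) <= C / a.+1%:R.
Proof.
move=> /zeta_tail[C hC]; have [l hl hl'] := ctends_cauchy hC.
exists C => a; suff -> : Li p z = l by [].
by apply: ctends_csum; under eq_fun do rewrite -zetaE.
Qed.

(** Admits partial sums and their products as weights, so that the series [Rsum] converge even when
    q = 1. *)
Lemma slow_zeta p z : summable_pair p z -> slow (fun n => zeta n p z).
Proof.
move=> pz; have [C hC] := zeta_tail pz; have [p0 z1 _] := pz.
have C0 : 0 <= C by have := le_trans (cabs_ge0 _) (hC 0%N 0%N (leqnn _)); rewrite divr1.
exists (C + 1) => n; split.
  by have := hC 0%N n (leq0n _); rewrite zeta0 subr0 divr1 => h; lra.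
rewrite zeta_increment // big_nat1 cabsM cabsX z1 expr1n mul1r cabsV cabsX cabs_nat.
apply: le_trans (_ : n.+1%:R^-1 <= _).
  rewrite lef_pV2 ?posrE ?exprn_gt0 ?ltr0n // -[X in X <= _]expr1.
  by rewrite ler_weXn2l // ler1n.
by rewrite -[X in X <= _]mul1r ler_wpM2r ?invr_ge0 // lerDr.
Qed.

Definition wsum z r w N : R[i] :=
  \sum_(0 <= n < N) z ^+ n / (n%:R + 2^-1) ^+ r * w n.

(** Common form of [ti] and [Rsum]: the weight 1 gives z^-1 times [ti], products of partial sums
    give [Rsum]. Limits are expanded by linearity in the weight. *)
Definition wlim z r w : R[i] := csum (fun n => z ^+ n / (n%:R + 2^-1) ^+ r * w n).

Lemma ctends_wsum z r w : summable_pair r z -> slow w ->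
  ctends (wsum z r w) (wlim z r w).
Proof.
move=> [r0 z1 rz] sw.
have [C hC] := slow_series z1 r0 rz (@shift_ok_half R) sw.
have [a b ab|l hl _] := @ctends_cauchy _ (wsum z r w) C.
  by rewrite /wsum (@big_cat_nat _ _ _ a 0 b) //= addDB; apply: hC.
suff -> : wlim z r w = l by [].
exact: ctends_csum.
Qed.

Lemma ti_partE N p z : ti_part N p z = z * wsum z p (fun=> 1) N.
Proof.
rewrite /ti_part /wsum big_add1 mulr_sumr; apply: eq_bigr => n _.
by rewrite natrS_half exprS; ring.
Qed.

Lemma tiE p z : summable_pair p z -> ti p z = z * wlim z p (fun=> 1).
Proof.
move=> pz; apply: ctends_csum.
have := ctendsZ z (ctends_wsum pz (slow_cst 1)).
congr (ctends _ _); apply/funext => N.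
by rewrite -ti_partE /ti_part big_add1.
Qed.

Lemma ctends_ti p z : summable_pair p z -> ctends (fun N => ti_part N p z) (ti p z).
Proof.
move=> pz; rewrite tiE //; under eq_fun do rewrite ti_partE.
exact/ctendsZ/ctends_wsum/slow_cst.
Qed.

Lemma Rsum1E p y r z : Rsum [:: (p, y)] r z = wlim z r (fun n => zeta n p y).
Proof.
rewrite /Rsum /wlim; congr csum; apply/funext => n.
by rewrite big_seq1 /=; ring.
Qed.

Lemma Rsum2E p1 y1 p2 y2 r z : Rsum [:: (p1, y1); (p2, y2)] r z
  = wlim z r (fun n => zeta n p1 y1 * zeta n p2 y2).
Proof.
rewrite /Rsum /wlim; congr csum; apply/funext => n.
by rewrite big_cons big_seq1 /=; ring.
Qed.

Lemma wlimD z r w v : summable_pair r z -> slow w -> slow v ->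
  wlim z r (fun n => w n + v n) = wlim z r w + wlim z r v.
Proof.
move=> rz sw sv; apply: ctends_csum.
have := ctendsD (ctends_wsum rz sw) (ctends_wsum rz sv).
congr (ctends _ _); apply/funext => N; rewrite /wsum -big_split /=.
by apply: eq_bigr => n _; rewrite mulrDr.
Qed.

Lemma wlimZ z r w l : summable_pair r z -> slow w ->
  wlim z r (fun n => l * w n) = l * wlim z r w.
Proof.
move=> rz sw; apply: ctends_csum.
have := ctendsZ l (ctends_wsum rz sw).
congr (ctends _ _); apply/funext => N; rewrite /wsum mulr_sumr.
by apply: eq_bigr => n _; rewrite mulrCA.
Qed.

Lemma slowD w v : slow w -> slow v -> slow (fun n => w n + v n).
Proof.
move=> [C hC] [D hD]; exists (C + D) => n.
have [u1 u2] := hC n; have [v1 v2] := hD n.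
split; first by apply: le_trans (cabsD _ _) _; rewrite lerD.
rewrite opprD addrACA mulrDl; apply: le_trans (cabsD _ _) _; exact: lerD.
Qed.

Lemma slowZ l w : slow w -> slow (fun n => l * w n).
Proof. by apply: slowM; apply: slow_cst. Qed.

(* The error 1/(K - n + 1) is what replacing a partial sum of length K - n by
   the full series costs. *)
Definition approx f g := exists C, forall K n, (n <= K)%N ->
  cabs (f K n - g n) <= C / (K - n).+1%:R /\ cabs (g n) <= C.

Lemma slow_bounded w : slow w -> exists C, forall n, cabs (w n) <= C.
Proof. by move=> [C hC]; exists C => n; case: (hC n). Qed.

Lemma approx_slow w : slow w -> approx (fun=> w) w.
Proof.
move=> /slow_bounded[C hC]; exists C => K n nK; split=> //.
by rewrite subrr cabs0 divr_ge0 // (le_trans (cabs_ge0 _) (hC 0%N)).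
Qed.

Lemma approxD f g f' g' : approx f g -> approx f' g' ->
  approx (fun K n => f K n + f' K n) (fun n => g n + g' n).
Proof.
move=> [C hC] [D hD]; exists (C + D) => K n nK.
have [u1 u2] := hC K n nK; have [v1 v2] := hD K n nK; split.
  by rewrite opprD addrACA mulrDl; apply: le_trans (cabsD _ _) _; exact: lerD.
by apply: le_trans (cabsD _ _) _; exact: lerD.
Qed.

Lemma approxM f g f' g' : approx f g -> approx f' g' ->
  approx (fun K n => f K n * f' K n) (fun n => g n * g' n).
Proof.
move=> [C hC] [D hD]; exists (C * D + C * D + C * D) => K n nK.
have [u1 u2] := hC K n nK; have [v1 v2] := hD K n nK.
have C0 := le_trans (cabs_ge0 _) u2; have D0 := le_trans (cabs_ge0 _) v2.
have CD0 : 0 <= C * D by rewrite mulr_ge0.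
split; last by rewrite cabsM (le_trans (ler_pM _ _ u2 v2)) ?cabs_ge0 // -addrA lerDl addr_ge0.
have -> : f K n * f' K n - g n * g' n = (f K n - g n) * (f' K n - g' n)
   + (f K n - g n) * g' n + g n * (f' K n - g' n) by ring.
(* In the product of two errors one is bounded by its constant, so the other alone supplies 1/(K - n
   + 1). *)
have v3 : cabs (f' K n - g' n) <= D.
  by apply: le_trans v1 _; rewrite ler_pdivrMr ?ltr0n // ler_peMr // ler1n.
rewrite [X in _ <= X]mulrDl [X in _ <= X + _]mulrDl.
apply: le_trans (cabsD _ _) _; apply: lerD.
  apply: le_trans (cabsD _ _) _; apply: lerD.
    by rewrite cabsM mulrAC ler_pM ?cabs_ge0.
  by rewrite cabsM mulrAC ler_pM ?cabs_ge0.
by rewrite cabsM -mulrA ler_pM ?cabs_ge0.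
Qed.

Lemma approxZ l f g : approx f g -> approx (fun K n => l * f K n) (fun n => l * g n).
Proof. by apply: approxM; apply/approx_slow/slow_cst. Qed.

(* The error is at most a multiple of sum_n 1/((n + 1)(K - n + 1)) = O(log K / K). *)
Lemma ctends_approx z r f g : summable_pair r z -> slow g -> approx f g ->
  ctends (fun K => \sum_(0 <= n < K.+1) z ^+ n / (n%:R + 2^-1) ^+ r * f K n)
         (wlim z r g).
Proof.
move=> rz sg [C hC]; have [r0 z1 _] := rz.
have C0 : 0 <= C by have [_ h] := hC 0%N 0%N isT; exact: le_trans (cabs_ge0 _) h.
have lim0 : ctends (fun K => \sum_(0 <= n < K.+1)
    z ^+ n / (n%:R + 2^-1) ^+ r * (f K n - g n)) 0.
  (* With a = n + 1 and b = K - n + 1 one has 1/(a b) = (1/a + 1/b) / (a + b) and a + b > K + 1. By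
     the symmetry of n and K - n the sum is at most 2 [H K], a Cesaro mean of a null sequence. *)
  pose H := arithmetic_mean (@harmonic R).
  apply: (ctends_le (b := fun K => 2 ^+ r * C * 2 * H K)); last first.
    rewrite -(mulr0 (2 ^+ r * C * 2)); apply: cvgM; first exact: cvg_cst.
    exact/cesaro/cvg_harmonic.
  move=> K; rewrite subr0; apply: le_trans (cabs_sum _ _ _) _.
  have hH : 2 * H K = K.+1%:R^-1 * \sum_(0 <= n < K.+1) (n.+1%:R^-1 + (K - n).+1%:R^-1).
    rewrite big_split /= [X in _ + X]big_nat_rev /= /H /arithmetic_mean /= seriesEnat.
    rewrite mulrCA mulr_natl mulr2n; congr (_ * (_ + _)).
    by apply: eq_big_nat => n /andP[_ nK]; rewrite add0n; congr (_.+1%:R^-1); lia.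
  rewrite -mulrA hH mulrA mulr_sumr ler_sum_nat // => n /andP[_ nK].
  rewrite !cabsM cabsX z1 expr1n mul1r.
  have [h1 _] := hC K n nK; have h2 := cabs_shift_pow n (@shift_ok_half R) r0.
  apply: le_trans (ler_pM _ _ h2 h1) _; rewrite ?cabs_ge0 //.
  have -> : 2 ^+ r / n.+1%:R * (C / (K - n).+1%:R)
    = 2 ^+ r * C * (n.+1%:R^-1 * (K - n).+1%:R^-1) by ring.
  rewrite -[X in _ <= X]mulrA; apply: ler_wpM2l; first by rewrite mulr_ge0 ?exprn_ge0.
  rewrite -ler_pdivrMl ?invr_gt0 ?ltr0n // invrK.
  have a0 : (0 : R) < n.+1%:R by rewrite ltr0n.
  have b0 : (0 : R) < (K - n).+1%:R by rewrite ltr0n.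
  have -> : (n.+1%:R : R)^-1 + (K - n).+1%:R^-1
    = (n.+1%:R + (K - n).+1%:R) * (n.+1%:R^-1 * (K - n).+1%:R^-1).
    by move: a0 b0; move: (n.+1%:R : R) ((K - n).+1%:R : R) => a b a0 b0;
       field; rewrite !lt0r_neq0.
  apply: ler_wpM2r; first by rewrite mulr_ge0 ?invr_ge0.
  by rewrite -natrD ler_nat; lia.
have := ctendsD lim0 (ctends_comp (phi := succn) (fun n => leqnSn n) (ctends_wsum rz sg)).
rewrite add0r; congr (ctends _ _); apply/funext => K; rewrite /wsum -big_split /=.
by apply: eq_bigr => n _; rewrite -mulrDr subrK.
Qed.

Lemma approx_zeta_sub p z : summable_pair p z ->
  approx (fun K n => zeta (K - n) p z) (fun=> Li p z).
Proof.
move=> /zeta_Li_bound[C hC]; exists (C + cabs (Li p z)) => K n nK; split.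
  apply: le_trans (hC _) _; rewrite ler_wpM2r ?invr_ge0 // lerDl cabs_ge0 //.
by rewrite lerDr; have := le_trans (cabs_ge0 _) (hC 0%N); rewrite divr1.
Qed.

Definition alpha_lim p z k n : R[i] :=
  (-1) ^+ k * Li (k + p) z + (-1) ^+ p * zeta n (k + p) z^-1.

Definition beta_lim z k : R[i] := (-1) ^+ k * Li k.+1 z - Li k.+1 z^-1.

Lemma slow_alpha p z k : summable_pair p z -> slow (alpha_lim p z k).
Proof.
move=> pz; apply: slowD; first exact: slow_cst.
exact/slowZ/slow_zeta/summable_pairV/summable_pairD.
Qed.

Lemma approx_alpha p z k : summable_pair p z -> approx (alpha p z k) (alpha_lim p z k).
Proof.
move=> pz; have kpz := summable_pairD k pz; apply: approxD.
  exact/approxZ/approx_zeta_sub.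
exact/approxZ/approx_slow/slow_zeta/summable_pairV.
Qed.

(* For z = 1 and k = 0 the two harmonic sums differ by at most 2n/(N - n + 1),
   which is why N is taken quadratic in K. *)
Lemma approx_beta z k : cabs z = 1 ->
  approx (fun K => beta z k (K * K + K)) (fun=> beta_lim z k).
Proof.
move=> z1; have [kz|/contrapT[k0 z1']] := pselect ((k.+1, z) <> (1%N, 1)).
  have pz : summable_pair k.+1 z by split.
  have mono C K n N : 0 <= C -> (K - n <= N)%N -> C / N.+1%:R <= C / (K - n).+1%:R :> R.
    by move=> C0 h; rewrite ler_wpM2l // lef_pV2 ?posrE ?ltr0n // ler_nat ltnS.
  have bd y (h : summable_pair k.+1 y) (s : nat -> nat -> nat) :
      (forall K n, (n <= K)%N -> (K - n <= s K n)%N) ->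
      approx (fun K n => zeta (s K n) k.+1 y) (fun=> Li k.+1 y).
    move=> hs; have [C hC] := zeta_Li_bound h.
    have C0 : 0 <= C by have := le_trans (cabs_ge0 _) (hC 0%N); rewrite divr1.
    exists (C + cabs (Li k.+1 y)) => K n nK; split; last by rewrite lerDr.
    apply: le_trans (hC _) _; apply: le_trans (mono _ _ _ _ C0 (hs _ _ nK)) _.
    by rewrite ler_wpM2r ?invr_ge0 // lerDl cabs_ge0.
  have h1 := approxZ ((-1) ^+ k) (bd z pz (fun K n => K * K + K - n)%N _).
  have h2 := approxZ (-1) (bd _ (summable_pairV pz) (fun K n => K * K + K + n)%N _).
  have := approxD (h1 _) (h2 _).
  rewrite /beta_lim /beta.
  under [X in _ -> _ -> approx X _]eq_fun do under eq_fun do rewrite mulN1r.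
  under [X in _ -> _ -> approx _ X]eq_fun do rewrite mulN1r.
  by apply => K n nK; nia.
have -> : k = 0%N by case: k0.
(* The unspecified value [Li 1 1] cancels here, leaving the limit 0. *)
rewrite /beta_lim z1' invr1 expr0 mul1r subrr /beta; exists 2 => K n nK.
rewrite cabs0; split => //; rewrite invr1 expr0 mul1r subr0 cabsC.
rewrite zeta_increment; last lia.
apply: le_trans (cabs_sum _ _ _) _.
apply: le_trans (_ : \sum_(K * K + K - n <= i < K * K + K + n)
   (K * K + K - n).+1%:R^-1 <= _).
  apply: ler_sum_nat => i /andP[hi _].
  rewrite expr1n mul1r cabsV expr1 cabs_nat lef_pV2 ?posrE ?ltr0n //.
  by rewrite ler_nat ltnS.
rewrite sumr_const_nat -[X in X <= _]mulr_natl ler_pdivrMr ?ltr0n //.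
rewrite mulrAC ler_pdivlMr ?ltr0n //.
by rewrite -!natrM ler_nat; nia.
Qed.

End Series.

(** * Passage to the limit *)

Section Limits.
Variable R : realType.
Implicit Types (z l d y : R[i]) (u v w g : nat -> R[i]) (C : R) (f : nat -> nat -> R[i]).

Lemma cabs1_neq0 z : cabs z = 1 -> z != 0.
Proof. by move=> h; rewrite -cabs_eq0 h oner_eq0. Qed.

Lemma cabs_wterm z r n : cabs z = 1 -> (0 < r)%N ->
  cabs (z ^+ n / (n%:R + 2^-1) ^+ r) <= 2 ^+ r / n.+1%:R.
Proof.
move=> z1 r0; rewrite cabsM cabsX z1 expr1n mul1r.
exact: cabs_shift_pow (@shift_ok_half R) r0.
Qed.

(** Each bracket is an increment from m on, hence O(1/(m + 1)), and replacing its upper end by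
    infinity costs O(1/(K + 1)). With the weight, the total error is 1/(K + 1) times a sum of 1/(m +
    1)^2, whatever the number of terms. *)
Lemma ctends_positive_poles p1 p2 q (x1 x2 X : R[i]) : summable_pair p1 x1 ->
  summable_pair p2 x2 -> summable_pair q X ->
  ctends (fun K => \sum_(0 <= m < K * K + K) X ^+ m.+1 / (m%:R + 2^-1) ^+ q
     * ((zeta (K + m.+1) p1 x1 - zeta m p1 x1)
        * (zeta (K + m.+1) p2 x2 - zeta m p2 x2)))
   (X * wlim X q (fun n => (Li p1 x1 - zeta n p1 x1) * (Li p2 x2 - zeta n p2 x2))).
Proof.
move=> pz1 pz2 qX; have [q0 X1 _] := qX.
pose G n := (Li p1 x1 - zeta n p1 x1) * (Li p2 x2 - zeta n p2 x2).
pose D K m := (zeta (K + m.+1) p1 x1 - zeta m p1 x1)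
        * (zeta (K + m.+1) p2 x2 - zeta m p2 x2) - G m.
have sG : slow G.
  by rewrite /G; apply: slowM; apply: slowD (slow_cst _) _; under eq_fun do rewrite -mulN1r;
    exact/slowZ/slow_zeta.
have [C1 hC1] := zeta_tail pz1; have [D1 hD1] := zeta_Li_bound pz1.
have [C2 hC2] := zeta_tail pz2; have [D2 hD2] := zeta_Li_bound pz2.
have pos C p z : (forall a, cabs (zeta a p z - Li p z) <= C / a.+1%:R) -> 0 <= C.
  by move=> h; have := le_trans (cabs_ge0 _) (h 0%N); rewrite divr1.
have D10 := pos _ _ _ hD1; have D20 := pos _ _ _ hD2.
have C20 : 0 <= C2 by have := le_trans (cabs_ge0 _) (hC2 0%N 0%N isT); rewrite divr1.
have hD K m : cabs (D K m) <= (D1 * C2 + D1 * D2) / K.+1%:R / m.+1%:R.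
  have -> : D K m = (zeta (K + m.+1) p1 x1 - Li p1 x1)
        * (zeta (K + m.+1) p2 x2 - zeta m p2 x2)
      + (zeta m p1 x1 - Li p1 x1) * (Li p2 x2 - zeta (K + m.+1) p2 x2).
    by rewrite /D /G; ring.
  have mono (E : R) : 0 <= E -> E / (K + m.+1).+1%:R <= E / K.+1%:R.
    by move=> E0; rewrite ler_wpM2l // lef_pV2 ?posrE ?ltr0n // ler_nat; lia.
  apply: le_trans (cabsD _ _) _; rewrite [X in _ <= X / _]mulrDl.
  rewrite [X in _ <= X]mulrDl !cabsM; apply: lerD.
    have -> : D1 * C2 / K.+1%:R * m.+1%:R^-1 = D1 / K.+1%:R * (C2 / m.+1%:R) by ring.
    rewrite ler_pM ?cabs_ge0 //; last by apply: hC2; lia.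
    exact: le_trans (hD1 _) (mono _ D10).
  have -> : D1 * D2 / K.+1%:R * m.+1%:R^-1 = D1 / m.+1%:R * (D2 / K.+1%:R) by ring.
  rewrite ler_pM ?cabs_ge0 // cabsC.
  exact: le_trans (hD2 _) (mono _ D20).
have lim0 : ctends (fun K => \sum_(0 <= m < K * K + K)
    X ^+ m / (m%:R + 2^-1) ^+ q * D K m) 0.
  apply: (@ctends_harmonic_bound _ _ _ (2 ^+ q * (D1 * C2 + D1 * D2) * 2)) => K.
  rewrite subr0; apply: le_trans (cabs_sum _ _ _) _.
  have E0 : 0 <= 2 ^+ q * (D1 * C2 + D1 * D2) / K.+1%:R.
    by rewrite divr_ge0 ?mulr_ge0 ?exprn_ge0 ?addr_ge0 ?mulr_ge0.
  have := ler_wpM2l E0 (sum_inv_square_le R 0 (K * K + K)).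
  rewrite divr1 [X in _ <= X]mulrAC; apply: le_trans.
  rewrite mulr_sumr; apply: ler_sum => m _.
  rewrite cabsM; apply: le_trans (ler_pM _ _ (cabs_wterm _ X1 q0) (hD K m)) _;
    rewrite ?cabs_ge0 //.
  by rewrite le_eqVlt; apply/orP; left; apply/eqP; rewrite -exprVn; ring.
have hphi K : (K <= K * K + K)%N by lia.
have := ctendsZ X (ctendsD lim0 (ctends_comp hphi (ctends_wsum qX sG))).
rewrite add0r; congr (ctends _ _); apply/funext => K; rewrite /wsum -big_split /=.
rewrite mulr_sumr; apply: eq_bigr => m _.
by rewrite /D exprS; ring.
Qed.

(** For n = j + K + 1 both windows start after j, so their product is O(1/(j + 1)^2) while the
    weight is O(1/(K + 1)). The bound is uniform in the upper end of the sum, which leaves N free to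
    be quadratic. *)
Lemma ctends_far_poles p1 p2 q (x1 x2 X : R[i]) : summable_pair p1 x1 ->
  summable_pair p2 x2 -> summable_pair q X ->
  ctends (fun K => \sum_(K.+1 <= n < (K * K + K).+1) X ^+ n / (n%:R + 2^-1) ^+ q
     * ((-1) ^+ p1 * (zeta n p1 x1 - zeta (n - K.+1) p1 x1)
        * ((-1) ^+ p2 * (zeta n p2 x2 - zeta (n - K.+1) p2 x2)))) 0.
Proof.
move=> pz1 pz2 [q0 X1 _].
have [C1 hC1] := zeta_tail pz1; have [C2 hC2] := zeta_tail pz2.
have pos C p z : (forall a b, (a <= b)%N ->
    cabs (zeta b p z - zeta a p z) <= C / a.+1%:R) -> 0 <= C.
  by move=> h; have := le_trans (cabs_ge0 _) (h 0%N 0%N isT); rewrite divr1.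
have C10 := pos _ _ _ hC1; have C20 := pos _ _ _ hC2.
apply: (@ctends_harmonic_bound _ _ _ (2 ^+ q * (C1 * C2) * 2)) => K.
rewrite subr0; apply: le_trans (cabs_sum _ _ _) _.
rewrite -{1}[K.+1]add0n big_addn.
have E0 : 0 <= 2 ^+ q * (C1 * C2) / K.+1%:R.
  by rewrite divr_ge0 ?mulr_ge0 ?exprn_ge0.
have := ler_wpM2l E0 (sum_inv_square_le R 0 ((K * K + K).+1 - K.+1)).
rewrite divr1 [X in _ <= X]mulrAC; apply: le_trans.
rewrite mulr_sumr; apply: ler_sum => j _; rewrite addnK.
have hw : cabs (X ^+ (j + K.+1) / ((j + K.+1)%:R + 2^-1) ^+ q) <= 2 ^+ q / K.+1%:R.
  apply: le_trans (cabs_wterm _ X1 q0) _.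
  by rewrite ler_wpM2l ?exprn_ge0 // lef_pV2 ?posrE ?ltr0n // ler_nat; lia.
have h1 := hC1 j (j + K.+1)%N (leq_addr _ _).
have h2 := hC2 j (j + K.+1)%N (leq_addr _ _).
rewrite !cabsM !cabs_sign !mul1r -!cabsM.
rewrite cabsM [X in _ * X]cabsM.
have -> : 2 ^+ q * (C1 * C2) / K.+1%:R * j.+1%:R ^- 2
  = 2 ^+ q / K.+1%:R * (C1 / j.+1%:R * (C2 / j.+1%:R)).
  by rewrite -exprVn; ring.
by rewrite !ler_pM ?mulr_ge0 ?cabs_ge0.
Qed.

(** * Residues at s = - n with n <= K *)

Section NearPoles.
Variables (X : R[i]) (q : nat).
Hypothesis qX : summable_pair q X.

Definition near_sum f K := \sum_(0 <= n < K.+1) X ^+ n * f K n.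

Lemma near_sumD f f' l l' : ctends (near_sum f) l -> ctends (near_sum f') l' ->
  ctends (near_sum (fun K n => f K n + f' K n)) (l + l').
Proof.
move=> h h'; have := ctendsD h h'; congr (ctends _ _); apply/funext => K.
by rewrite /near_sum -big_split; apply: eq_bigr => n _; rewrite mulrDr.
Qed.

Lemma near_sum_sum (I : Type) (r : seq I) (P : pred I) (F : I -> nat -> nat -> R[i])
    (L : I -> R[i]) : (forall i, P i -> ctends (near_sum (F i)) (L i)) ->
  ctends (near_sum (fun K n => \sum_(i <- r | P i) F i K n)) (\sum_(i <- r | P i) L i).
Proof.
move=> h; have := ctends_sum r h; congr (ctends _ _); apply/funext => K.
by rewrite /near_sum exchange_big; apply: eq_bigr => n _; rewrite mulr_sumr.
Qed.

Lemma near_sum_term c r f g : (q <= r)%N -> slow g -> approx f g ->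
  ctends (near_sum (fun K n => c * ((n%:R + 2^-1) ^- r * f K n))) (c * wlim X r g).
Proof.
move=> qr sg fg; have rX := summable_pairW qr qX.
have := ctendsZ c (ctends_approx rX sg fg); congr (ctends _ _); apply/funext => K.
by rewrite /near_sum mulr_sumr; apply: eq_bigr => n _; ring.
Qed.

(** [local_residue] is a combination, of a length independent of K, of terms (n + 1/2)^-r f K n with
    r >= q, to each of which [ctends_approx] applies. *)
Lemma ctends_near_poles p1 p2 (x x1 x2 : R[i]) : cabs x = 1 ->
  summable_pair p1 x1 -> summable_pair p2 x2 ->
  ctends (near_sum (fun K => local_residue p1 p2 q x x1 x2 K (K * K + K)))
  ('C(q + p1 + p2 - 1, q - 1)%:R * wlim X (q + p1 + p2) (fun=> 1)
  + sum_sigma p1 x1 p2 x2 (fun pa xa pb xb =>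
      \sum_(k < pa.+1) 'C(k + pb - 1, pb - 1)%:R * 'C(q + pa - k - 1, q - 1)%:R
        * wlim X (q + pa - k) (alpha_lim pb xb k))
  + \sum_(k < p1 + p2) 'C(q + p1 + p2 - k - 2, q - 1)%:R
      * wlim X (q + p1 + p2 - k - 1) (fun=> beta_lim x k)
  + 1 * wlim X q (fun n => alpha_lim p1 x1 0 n * alpha_lim p2 x2 0 n)
  + sum_sigma p1 x1 p2 x2 (fun pa xa pb xb =>
      \sum_(k1 < pa) \sum_(k2 < pa | (k1 + k2 <= pa - 1)%N)
        'C(k2 + pb - 1, pb - 1)%:R * 'C(q + pa - k1 - k2 - 2, q - 1)%:R
        * wlim X (q + pa - k1 - k2 - 1) (fun n => beta_lim x k1 * alpha_lim pb xb k2 n))).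
Proof.
move=> z1 pz1 pz2; rewrite /local_residue.
have t2 pa pb xb : summable_pair pb xb -> ctends (near_sum (fun K n =>
      \sum_(k < pa.+1) 'C(k + pb - 1, pb - 1)%:R * 'C(q + pa - k - 1, q - 1)%:R
        * ((n%:R + 2^-1) ^- (q + pa - k) * alpha pb xb k K n)))
   (\sum_(k < pa.+1) 'C(k + pb - 1, pb - 1)%:R * 'C(q + pa - k - 1, q - 1)%:R
        * wlim X (q + pa - k) (alpha_lim pb xb k)).
  move=> pz; apply: near_sum_sum => -[k /= kp] _; apply: near_sum_term; first lia.
    exact: slow_alpha.
  exact: approx_alpha.
have t5 pa pb xb : summable_pair pb xb -> ctends (near_sum (fun K n =>
      \sum_(k1 < pa) \sum_(k2 < pa | (k1 + k2 <= pa - 1)%N)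
        'C(k2 + pb - 1, pb - 1)%:R * 'C(q + pa - k1 - k2 - 2, q - 1)%:R
        * ((n%:R + 2^-1) ^- (q + pa - k1 - k2 - 1)
           * (beta x k1 (K * K + K) n * alpha pb xb k2 K n))))
   (\sum_(k1 < pa) \sum_(k2 < pa | (k1 + k2 <= pa - 1)%N)
        'C(k2 + pb - 1, pb - 1)%:R * 'C(q + pa - k1 - k2 - 2, q - 1)%:R
        * wlim X (q + pa - k1 - k2 - 1) (fun n => beta_lim x k1 * alpha_lim pb xb k2 n)).
  move=> pz; apply: near_sum_sum => -[k1 /= k1p] _.
  apply: near_sum_sum => -[k2 /= k2p] hk; apply: near_sum_term; first lia.
    exact/slowZ/slow_alpha.
  by apply: approxM; [exact: approx_beta | exact: approx_alpha].
apply: near_sumD; last by apply: near_sumD; apply: t5.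
apply: near_sumD.
  apply: near_sumD; last first.
    apply: near_sum_sum => -[k /= kp] _; apply: near_sum_term; first lia.
      exact: slow_cst.
    exact: approx_beta.
  apply: near_sumD; last by apply: near_sumD; apply: t2.
  have := @near_sum_term 'C(q + p1 + p2 - 1, q - 1)%:R (q + p1 + p2)
    (fun _ _ => 1) (fun=> 1).
  under [X in near_sum X]eq_fun do under eq_fun do rewrite mulr1.
  apply; [lia | exact: slow_cst | exact/approx_slow/slow_cst].
have := @near_sum_term 1 q (fun K n => alpha p1 x1 0 K n * alpha p2 x2 0 K n)
    (fun n => alpha_lim p1 x1 0 n * alpha_lim p2 x2 0 n).
under [X in near_sum X]eq_fun do under eq_fun do rewrite mul1r.
apply => //; first by apply: slowM; exact: slow_alpha.
by apply: approxM; exact: approx_alpha.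
Qed.

End NearPoles.

(** For z = 1 and k = 0 the two sums diverge but differ by the single last term of the longer one,
    which tends to 0; in the limit the unspecified [ti 1 1] cancels. *)
Lemma ctends_twosided_ti k z : cabs z = 1 ->
  ctends (fun K => (-1) ^+ k * (z^-1 * ti_part (K * K + K).+1 k.+1 z)
                   - ti_part (K * K + K) k.+1 z^-1)
    ((-1) ^+ k * (z^-1 * ti k.+1 z) - ti k.+1 z^-1).
Proof.
move=> z1; have [kz|/contrapT[k0 z1']] := pselect ((k.+1, z) <> (1%N, 1)).
  have pz : summable_pair k.+1 z by split.
  apply: ctendsB; first apply/ctendsZ/ctendsZ.
    by apply: (ctends_comp (phi := fun K => (K * K + K).+1)) (ctends_ti pz) => n; lia.
  by apply: (ctends_comp (phi := fun K => K * K + K)%N) (ctends_ti (summable_pairV pz)) => n; lia.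
have -> : k = 0%N by case: k0.
rewrite z1' invr1 expr0 !mul1r subrr.
apply: (@ctends_harmonic_bound _ _ _ 2) => K; rewrite subr0 !mul1r.
rewrite /ti_part big_nat_recr //= addDB expr1n mul1r expr1 natrS_half.
have [_ h] := @shift_ok_half R (K * K + K)%N; apply: le_trans h _.
by rewrite ler_wpM2l // lef_pV2 ?posrE ?ltr0n // ler_nat; lia.
Qed.

Lemma ctends_half_pole p1 p2 q (x x1 x2 : R[i]) : cabs x = 1 ->
  summable_pair p1 x1 -> summable_pair p2 x2 ->
  ctends (fun K => \sum_(k1 < q) \sum_(k2 < q) \sum_(k3 < q | (k1 + k2 + k3 == q - 1)%N)
      ((-1) ^+ k1 * (x^-1 * ti_part (K * K + K).+1 k1.+1 x)
       - ti_part (K * K + K) k1.+1 x^-1)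
      * ('C(k2 + p1 - 1, p1 - 1)%:R
         * ((-1) ^+ k2 * (x1^-1 * ti_part K.+1 (k2 + p1) x1)))
      * ('C(k3 + p2 - 1, p2 - 1)%:R
         * ((-1) ^+ k3 * (x2^-1 * ti_part K.+1 (k3 + p2) x2))))
   (\sum_(k1 < q) \sum_(k2 < q) \sum_(k3 < q | (k1 + k2 + k3 == q - 1)%N)
      ((-1) ^+ k1 * (x^-1 * ti k1.+1 x) - ti k1.+1 x^-1)
      * ('C(k2 + p1 - 1, p1 - 1)%:R * ((-1) ^+ k2 * (x1^-1 * ti (k2 + p1) x1)))
      * ('C(k3 + p2 - 1, p2 - 1)%:R * ((-1) ^+ k3 * (x2^-1 * ti (k3 + p2) x2)))).
Proof.
move=> z1 pz1 pz2.
apply: ctends_sum => k1 _; apply: ctends_sum => k2 _; apply: ctends_sum => k3 _.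
have tail k p z : summable_pair p z -> ctends (fun K => ti_part K.+1 (k + p) z) (ti (k + p) z).
  by move=> pz; exact: ctends_comp leqnSn (ctends_ti (summable_pairD k pz)).
exact: ctendsM (ctendsM (ctends_twosided_ti k1 z1)
  (ctendsZ _ (ctendsZ _ (ctendsZ _ (tail k2 _ _ pz1)))))
  (ctendsZ _ (ctendsZ _ (ctendsZ _ (tail k3 _ _ pz2)))).
Qed.

End Limits.

(** * Evaluation of the limits and assembly of the formula *)

Lemma ctends_eq0 (R : realType) (u : nat -> R[i]) l :
  ctends u l -> (forall n, u n = 0) -> l = 0.
Proof.
move=> ul u0; apply: ctends_unique ul _; rewrite (_ : u = fun=> 0).
  exact: ctends_cst.
by apply/funext.
Qed.

Lemma wlim_cst (R : realType) r (X a : R[i]) : summable_pair r X ->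
  wlim X r (fun=> a) = a * (X^-1 * ti r X).
Proof.
move=> rX; have [_ X1 _] := rX; rewrite tiE // mulKf ?cabs1_neq0 //.
by rewrite -wlimZ //; [rewrite mulr1 | exact: slow_cst].
Qed.

(** Serves twice: with c = d = -1 for the tails at the positive poles, and with c = (-1)^p1, d =
    (-1)^p2 for the product of the two [alpha_lim] of order 0. *)
Lemma wlim_prod (R : realType) r (X a b c d : R[i]) (u v : nat -> R[i]) :
  summable_pair r X -> slow u -> slow v ->
  wlim X r (fun n => (a + c * u n) * (b + d * v n))
  = a * b * (X^-1 * ti r X) + a * d * wlim X r v + b * c * wlim X r u
    + c * d * wlim X r (fun n => u n * v n).
Proof.
move=> rX su sv; have suv := slowM su sv.
rewrite -(wlim_cst _ rX) -!wlimZ // -!wlimD //; try by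
  repeat first [apply: slowD | apply: slowZ | apply: slow_cst].
by congr wlim; apply/funext => n; ring.
Qed.

Lemma wlim_alphaE (R : realType) p k r (z X : R[i]) : summable_pair p z ->
  summable_pair r X -> wlim X r (alpha_lim p z k)
  = X^-1 * (-1) ^+ k * Li (k + p) z * ti r X
    + (-1) ^+ p * Rsum [:: ((k + p)%N, z^-1)] r X.
Proof.
move=> pz rX; have zV := summable_pairV (summable_pairD k pz).
rewrite /alpha_lim wlimD //; [|exact: slow_cst|exact/slowZ/slow_zeta].
rewrite wlim_cst // [wlim X r (fun n => _ * zeta n _ _)]wlimZ //; last exact: slow_zeta.
by rewrite Rsum1E; ring.
Qed.

Theorem theorem3p3 (R : realType) (x x1 x2 : R[i]) (p1 p2 q : nat)
    (hx : is_root_of_unity x) (hx1 : is_root_of_unity x1) (hx2 : is_root_of_unity x2)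
    (hp1 : (1 <= p1)%N) (hp2 : (1 <= p2)%N) (hq : (1 <= q)%N)
    (h1 : (p1, x1) <> (1%N, 1)) (h2 : (p2, x2) <> (1%N, 1))
    (hX : (q, x * x1 * x2) <> (1%N, 1)) :
  let X := x * x1 * x2 in
  X^-1 * Rsum [:: (p1, x1); (p2, x2)] q X^-1
    + (-1) ^+ (p1 + p2 + q) * Rsum [:: (p1, x1^-1); (p2, x2^-1)] q X
  = - (Li p1 x1 * Li p2 x2 * ti q X^-1)
    + X^-1 * sum_sigma p1 x1 p2 x2 (fun pa xa pb xb =>
        Li pa xa * Rsum [:: (pb, xb)] q X^-1)
    - (-1) ^+ q * X^-1 * 'C(q + p1 + p2 - 1, q - 1)%:R * ti (q + p1 + p2) X
    - (-1) ^+ q * sum_sigma p1 x1 p2 x2 (fun pa xa pb xb =>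
        \sum_(k < pa.+1)
          'C(k + pb - 1, pb - 1)%:R * 'C(q + pa - k - 1, q - 1)%:R
          * (X^-1 * (-1) ^+ k * Li (k + pb) xb * ti (q + pa - k) X
             + (-1) ^+ pb * Rsum [:: ((k + pb)%N, xb^-1)] (pa + q - k) X))
    - (-1) ^+ q * X^-1 * (\sum_(k < p1 + p2)
          'C(q + p1 + p2 - k - 2, q - 1)%:R
          * ((-1) ^+ k * Li k.+1 x - Li k.+1 x^-1)
          * ti (q + p1 + p2 - k - 1) X)
    - (-1) ^+ q * X^-1 * Li p1 x1 * Li p2 x2 * ti q X
    - (-1) ^+ q * sum_sigma p1 x1 p2 x2 (fun pa xa pb xb =>
        (-1) ^+ pb * Li pa xa * Rsum [:: (pb, xb^-1)] q X)
    - (-1) ^+ q * sum_sigma p1 x1 p2 x2 (fun pa xa pb xb =>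
        \sum_(k1 < pa) \sum_(k2 < pa | (k1 + k2 <= pa - 1)%N)
          'C(k2 + pb - 1, pb - 1)%:R * 'C(q + pa - k1 - k2 - 2, q - 1)%:R
          * ((-1) ^+ k1 * Li k1.+1 x - Li k1.+1 x^-1)
          * (X^-1 * (-1) ^+ k2 * Li (k2 + pb) xb * ti (q + pa - k1 - k2 - 1) X
             + (-1) ^+ pb
               * Rsum [:: ((k2 + pb)%N, xb^-1)] (pa + q - k1 - k2 - 1) X))
    - \sum_(k1 < q) \sum_(k2 < q) \sum_(k3 < q | (k1 + k2 + k3 == q - 1)%N)
          ((-1) ^+ k1 * ti k1.+1 x - x * ti k1.+1 x^-1)
          * (-1) ^+ (k2 + k3)
          * 'C(k2 + p1 - 1, p1 - 1)%:R * 'C(k3 + p2 - 1, p2 - 1)%:R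
          * X^-1 * ti (k2 + p1) x1 * ti (k3 + p2) x2.
Proof.
move=> X.
have cx := cabs_root_of_unity hx; have cx1 := cabs_root_of_unity hx1.
have cx2 := cabs_root_of_unity hx2.
have x0 := cabs1_neq0 cx; have x10 := cabs1_neq0 cx1; have x20 := cabs1_neq0 cx2.
have s1 : summable_pair p1 x1 by split.
have s2 : summable_pair p2 x2 by split.
have sX : summable_pair q X by split=> //; rewrite !cabsM cx cx1 cx2 !mulr1.
have sXV := summable_pairV sX.
have lim := ctendsD (ctendsD (ctendsD (ctends_positive_poles s1 s2 sXV)
    (ctendsZ ((-1) ^+ q) (ctends_near_poles sX cx s1 s2)))
    (ctendsZ ((-1) ^+ q) (ctends_far_poles (summable_pairV s1) (summable_pairV s2) sX)))
    (ctends_half_pole q cx s1 s2).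
have total := ctends_eq0 lim (fun K => finite_identity (leq_addl (K * K) K)
  hp1 hp2 hq x0 x10 x20).
have defX : X = x * x1 * x2 by [].
have X0 : X != 0 by rewrite defX !mulf_neq0.
(* From here on [X] is an atom for [ring]; [defX] recalls its value where X^-1 has to be assembled
   from x^-1, x1^-1 and x2^-1. *)
clearbody X; have z1 := slow_zeta s1; have z2 := slow_zeta s2.
have z1V := slow_zeta (summable_pairV s1); have z2V := slow_zeta (summable_pairV s2).
have XX t : X^-1 * (X * t) = t by rewrite mulKf.
have eG : X^-1 * wlim X^-1 q (fun n => (Li p1 x1 - zeta n p1 x1) * (Li p2 x2 - zeta n p2 x2))
  = Li p1 x1 * Li p2 x2 * ti q X^-1
    - X^-1 * (Li p1 x1 * Rsum [:: (p2, x2)] q X^-1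
              + Li p2 x2 * Rsum [:: (p1, x1)] q X^-1)
    + X^-1 * Rsum [:: (p1, x1); (p2, x2)] q X^-1.
  under [X in wlim _ _ X]eq_fun do rewrite -[zeta _ p1 _]mul1r -[zeta _ p2 _]mul1r -!mulNr.
  by rewrite wlim_prod // invrK -!Rsum1E -Rsum2E !mulrDr [X^-1 * (_ * (X * _))]mulrCA XX; ring.
have eA : wlim X q (fun n => alpha_lim p1 x1 0 n * alpha_lim p2 x2 0 n)
  = X^-1 * Li p1 x1 * Li p2 x2 * ti q X
    + ((-1) ^+ p2 * Li p1 x1 * Rsum [:: (p2, x2^-1)] q X
       + (-1) ^+ p1 * Li p2 x2 * Rsum [:: (p1, x1^-1)] q X)
    + (-1) ^+ (p1 + p2) * Rsum [:: (p1, x1^-1); (p2, x2^-1)] q X.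
  rewrite /alpha_lim (wlim_prod _ _ _ _ sX z1V z2V) !add0n !expr0 -!Rsum1E -Rsum2E exprD.
  move: (Rsum _ q X) (Rsum _ q X) (Rsum _ q X) (Li p1 x1) (Li p2 x2) (ti q X).
  by move=> R1 R2 R3 L1 L2 t; ring.
have rX r : (q <= r)%N -> summable_pair r X by move=> qr; exact: summable_pairW sX.
have e2 pa pb xb : summable_pair pb xb ->
  \sum_(k < pa.+1) 'C(k + pb - 1, pb - 1)%:R * 'C(q + pa - k - 1, q - 1)%:R
        * wlim X (q + pa - k) (alpha_lim pb xb k)
  = \sum_(k < pa.+1)
          'C(k + pb - 1, pb - 1)%:R * 'C(q + pa - k - 1, q - 1)%:R
          * (X^-1 * (-1) ^+ k * Li (k + pb) xb * ti (q + pa - k) X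
             + (-1) ^+ pb * Rsum [:: ((k + pb)%N, xb^-1)] (pa + q - k) X).
  move=> pz; apply: eq_bigr => -[k /= kp] _; rewrite wlim_alphaE //; last first.
    by apply: rX; lia.
  by rewrite [(pa + q)%N]addnC.
have e3 : \sum_(k < p1 + p2) 'C(q + p1 + p2 - k - 2, q - 1)%:R
      * wlim X (q + p1 + p2 - k - 1) (fun=> beta_lim x k)
  = X^-1 * (\sum_(k < p1 + p2) 'C(q + p1 + p2 - k - 2, q - 1)%:R
          * ((-1) ^+ k * Li k.+1 x - Li k.+1 x^-1) * ti (q + p1 + p2 - k - 1) X).
  rewrite mulr_sumr; apply: eq_bigr => -[k /= kp] _; rewrite wlim_cst; last first.
    by apply: rX; lia.
  rewrite /beta_lim; move: ('C(_, _)%:R : R[i]) (Li _ x) (Li _ x^-1) (ti _ X) => c L L' t.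
  ring.
have e5 pa pb xb : summable_pair pb xb ->
  \sum_(k1 < pa) \sum_(k2 < pa | (k1 + k2 <= pa - 1)%N)
        'C(k2 + pb - 1, pb - 1)%:R * 'C(q + pa - k1 - k2 - 2, q - 1)%:R
        * wlim X (q + pa - k1 - k2 - 1) (fun n => beta_lim x k1 * alpha_lim pb xb k2 n)
  = \sum_(k1 < pa) \sum_(k2 < pa | (k1 + k2 <= pa - 1)%N)
          'C(k2 + pb - 1, pb - 1)%:R * 'C(q + pa - k1 - k2 - 2, q - 1)%:R
          * ((-1) ^+ k1 * Li k1.+1 x - Li k1.+1 x^-1)
          * (X^-1 * (-1) ^+ k2 * Li (k2 + pb) xb * ti (q + pa - k1 - k2 - 1) X
             + (-1) ^+ pb
               * Rsum [:: ((k2 + pb)%N, xb^-1)] (pa + q - k1 - k2 - 1) X).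
  move=> pz; apply: eq_bigr => -[k1 /= k1p] _; apply: eq_bigr => -[k2 /= k2p] hk.
  have qr : (q <= q + pa - k1 - k2 - 1)%N by lia.
  rewrite wlimZ ?wlim_alphaE //; [|exact: rX|exact: rX|exact: slow_alpha].
  rewrite [(pa + q)%N]addnC /beta_lim -!mulrA; congr (_ * (_ * _)).
have e0 : \sum_(k1 < q) \sum_(k2 < q) \sum_(k3 < q | (k1 + k2 + k3 == q - 1)%N)
      ((-1) ^+ k1 * (x^-1 * ti k1.+1 x) - ti k1.+1 x^-1)
      * ('C(k2 + p1 - 1, p1 - 1)%:R * ((-1) ^+ k2 * (x1^-1 * ti (k2 + p1) x1)))
      * ('C(k3 + p2 - 1, p2 - 1)%:R * ((-1) ^+ k3 * (x2^-1 * ti (k3 + p2) x2)))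
  = \sum_(k1 < q) \sum_(k2 < q) \sum_(k3 < q | (k1 + k2 + k3 == q - 1)%N)
          ((-1) ^+ k1 * ti k1.+1 x - x * ti k1.+1 x^-1)
          * (-1) ^+ (k2 + k3)
          * 'C(k2 + p1 - 1, p1 - 1)%:R * 'C(k3 + p2 - 1, p2 - 1)%:R
          * X^-1 * ti (k2 + p1) x1 * ti (k3 + p2) x2.
  apply: eq_bigr => k1 _; apply: eq_bigr => k2 _; apply: eq_bigr => k3 _.
  rewrite exprD defX !invfM.
  (* Only the first term of the bracket carries x^-1; pulling it out of both completes X^-1 and
     leaves the factor x in the formula. *)
  have e : ti k1.+1 x^-1 = x^-1 * (x * ti k1.+1 x^-1) by rewrite mulKf.
  rewrite {1}e.
  move: ('C(_, _)%:R : R[i]) ('C(_, _)%:R : R[i]) (ti _ x) (ti _ x^-1) (ti _ x1) (ti _ x2).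
  by move=> c c' t t' t1 t2; ring.
move: total; rewrite mulr0 addr0 eG eA e3 e0 wlim_cst; last by apply: rX; lia.
rewrite /sum_sigma (e2 _ _ _ s1) (e2 _ _ _ s2) (e5 _ _ _ s1) (e5 _ _ _ s2) => total.
move: total; rewrite !exprD.
move: (\sum_(k1 < q) _) (\sum_(k < p1 + p2) _) (\sum_(k < p1.+1) _)
  (\sum_(k < p2.+1) _) (\sum_(k1 < p1) _) (\sum_(k1 < p2) _) => S0 S3 S1 S2 S5 S6.
move: ('C(_, _)%:R : R[i]) (Rsum _ q X^-1) (Rsum _ q X^-1) (Rsum _ q X^-1)
  (Rsum _ q X) (Rsum _ q X) (Rsum _ q X) (Li p1 x1) (Li p2 x2)
  (ti q X) (ti q X^-1) (ti _ X) => c R1 R2 R3 R4 R5 R6 L1 L2 t1 t2 t3 total.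
(* The difference of the two sides is exactly the vanishing limit of the sum of residues. *)
by apply/eqP; rewrite -subr_eq0; apply/eqP; rewrite -[RHS]total; ring.
Qed.
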